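(* Every nontrivial reduced knot projection on $S^2$ can be obtained from the trefoil projection by a finite sequence of half-twisted splices $A$ and inverse half-twisted splices $A^{-1}$ such that the knot projection resulting from each step of the sequence is reduced.
   Context: A knot projection is a closed curve in the 2-sphere $S^2$ that is the image of an immersion $S^1\to S^2$ whose only singularities are finitely many transverse double points, called crossings; knot projections are considered up to isotopy of $S^2$. It is trivial if it has no crossings, nontrivial otherwise. The trefoil projection is the standard 3-crossing knot projection (the shadow of the standard trefoil diagram, i.e. of the closure of the 2-strand braid $\sigma_1^3$); its five complementary regions are two triangles and three bigons. A crossing $c$ of a knot projection $P$ is reducible if the four corners of $S^2\setminus P$ at $c$ do not lie in four pairwise distinct regions of $S^2\setminus P$ (equivalently, some simple closed curve in $S^2$ meets $P$ only in $c$); $P$ is reduced if it has no reducible crossing. Half-twisted splice $A$: let $D\subset S^2$ be a disk such that $P\cap D$ consists of two disjoint arcs without crossings, with endpoints $p_1,p_2,p_3,p_4$ in this cyclic order on $\partial D$, one arc joining $p_1,p_2$ and the other joining $p_3,p_4$; $A$ replaces these two arcs by two arcs in $D$ joining $p_1$ to $p_3$ and $p_2$ to $p_4$ that cross each other transversely exactly once, leaving $P$ unchanged outside $D$; it is applied only when the result is again a single closed curve (equivalently, the two arcs are traversed in opposite directions relative to each other). The inverse move $A^{-1}$ at a crossing $c$ replaces a small disk neighborhood of $c$ by the smoothing of $c$ (two disjoint arcs) for which the result is a single closed curve (the non-orientation-respecting smoothing). *)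

(* Defs.v *)
(* Knot projections on S^2 are encoded combinatorially as
   oriented combinatorial maps (rotation systems) of 4-regular connected
   plane graphs whose straight-ahead curve is a single closed curve. *)
From HB Require Import structures.
From mathcomp Require Import all_boot all_order all_fingroup.
Set Implicit Arguments. Unset Strict Implicit. Unset Printing Implicit Defensive.

(* A NONTRIVIAL knot projection (at least one crossing).
   kd     : darts (half-edges); 4 per crossing, 2 per edge;
   ksig   : counterclockwise rotation of the darts around their crossing;
   kalp   : the involution exchanging the two darts of an edge.
   Crossings = cycles of ksig, edges = cycles of kalp,
   regions of S^2 \ P = cycles of the face permutation x |-> ksig (kalp x).
   Straight-ahead continuation through a crossing: x |-> kalp (ksig (ksig x)). *)
Record kproj := KProj {
  kd : finType;
  ksig : {perm kd};
  kalp : {perm kd};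
  kproj_nonempty : 0 < #|kd|;
  kproj_deg4 : forall x, ksig (ksig (ksig (ksig x))) = x /\ ksig x != x /\ ksig (ksig x) != x;
  kproj_edge : forall x, kalp (kalp x) = x /\ kalp x != x;
  kproj_conn : forall x y, connect (fun u v => (v == ksig u) || (v == kalp u)) x y;
  (* Euler formula V - E + F = 2 : the map is embedded in the sphere *)
  kproj_sphere : #|porbits ksig| + #|porbits (kalp * ksig)%g| = #|porbits kalp| + 2;
  (* the straight-ahead curve is a single closed curve (two orientations) *)
  kproj_single : #|porbits (ksig * ksig * kalp)%g| = 2
}.

Definition kphi (p : kproj) : {perm kd p} := (kalp p * ksig p)%g.

(* Reduced: at every crossing, the four corners lie in four distinct regions.
   The corner between darts y and ksig y lies in the region (face-cycle)
   containing ksig y, so corners at a crossing correspond bijectively to the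
   darts at that crossing. *)
Definition kreduced (p : kproj) : Prop :=
  forall x y : kd p, x != y -> y \in porbit (ksig p) x ->
    porbit (kphi p) x != porbit (kphi p) y.

(* Smoothing at the crossing of dart b: the four darts b, sb, s^2 b, s^3 b are
   removed and reconnected in pairs b <-> s b, s^2 b <-> s^3 b (choosing b or
   s b as the base dart gives the two possible smoothings). *)
Section Smoothing.
Variable p : kproj.
Local Notation s := (ksig p).
Local Notation a := (kalp p).

Definition at_v (b x : kd p) : bool := x \in porbit s b.

Definition tau (b x : kd p) : kd p :=
  if x == b then s b else if x == s b then b
  else if x == s (s b) then s (s (s b))
  else if x == s (s (s b)) then s (s b) else x.

(* the edge pairing after smoothing: follow the strand through the removed
   crossing until leaving it *)
Definition sm_alpha (b x : kd p) : kd p :=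
  let y := a x in
  if ~~ at_v b y then y else
  let z := a (tau b y) in
  if ~~ at_v b z then z else a (tau b z).

(* the smoothing creates no crossingless circle component *)
Definition nocircle (b : kd p) : Prop :=
  forall x, at_v b x -> a x != tau b x.

Definition smoothing (b : kd p) (q : kproj) : Prop :=
  exists f : kd q -> kd p,
    injective f /\
    (forall y, ~~ at_v b y <-> exists x, f x = y) /\
    (forall x, f (ksig q x) = s (f x)) /\
    (forall x, f (kalp q x) = sm_alpha b (f x)).
End Smoothing.

Inductive proj := Trivial | NT of kproj.

Definition preduced (P : proj) : Prop :=
  match P with Trivial => True | NT p => kreduced p end.

(* invA P Q : Q is obtained from P by an inverse half-twisted splice A^{-1},
   i.e. smoothing a crossing so that the result is a single closed curve.
   (Since both P and Q are required to be knot projections, i.e. single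
   curves, only the non-orientation-respecting smoothing qualifies.) *)
Definition invA (P Q : proj) : Prop :=
  match P with
  | Trivial => False
  | NT p => exists b : kd p, nocircle b /\
      (if #|kd p| == 4 then Q = Trivial
       else exists q, Q = NT q /\ smoothing b q)
  end.

Definition kstep (P Q : proj) : Prop := invA Q P \/ invA P Q.

Inductive reach (R : proj -> proj -> Prop) (ok : proj -> Prop) : proj -> proj -> Prop :=
| reach0 x : reach R ok x x
| reachS x y z : reach R ok x y -> R y z -> ok z -> reach R ok x z.

(* The trefoil projection on 12 darts: crossing i (i = 0,1,2) has darts
   4i+k, k = 0..3 in ccw order: outer edge to crossing i+2, outer edge to
   crossing i+1, inner edge to crossing i+1, inner edge to crossing i+2. *)
Definition tref_sig (x : 'I_12) : 'I_12 :=
  inord (4 * (x %/ 4) + (x %% 4).+1 %% 4).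
Definition tref_alp (x : 'I_12) : 'I_12 :=
  let i := x %/ 4 in
  match x %% 4 with
  | 0 => inord (4 * ((i + 2) %% 3) + 1)
  | 1 => inord (4 * ((i + 1) %% 3))
  | 2 => inord (4 * ((i + 1) %% 3) + 3)
  | _ => inord (4 * ((i + 2) %% 3) + 2)
  end.

Definition is_trefoil (t : kproj) : Prop :=
  exists f : kd t -> 'I_12, bijective f /\
    (forall x, f (ksig t x) = tref_sig (f x)) /\
    (forall x, f (kalp t x) = tref_alp (f x)).

(* Main.v *)
Require Import Defs.
From mathcomp Require Import all_boot all_order all_fingroup all_algebra.
From mathcomp Require Import ring lra zify.
Set Implicit Arguments. Unset Strict Implicit. Unset Printing Implicit Defensive.
Import GRing.Theory.

(** A projection is encoded by its signed cyclic Gauss word, and a word by its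
    interlacement graph [G]. Smoothing a crossing [c] so that one curve remains
    turns [c X c' Y] into [X^-1 Y], hence [G] into its local complement at [c]
    with [c] deleted, and a projection is reduced iff [G] has no isolated vertex.
    So [c] can be smoothed unless it has a true twin (an adjacent vertex with the
    same other neighbours).

    Two splices are always available: doubling a crossing [v] in its twist (a
    bigon) complements [G] at [v] and adds a false twin of [v]; a splice across
    an edge joining crossings [x], [y] of opposite signs (a triangle) adds a
    vertex adjacent to the symmetric difference of the neighbourhoods of [x] and
    [y]. If every vertex has a true twin, the first splice followed by two
    smoothings lowers the number of crossings, as long as some neighbour of a
    vertex is not its twin or some vertex has three neighbours. Otherwise [G] is
    a disjoint union of cliques of size at most 3; when there are several of
    them, the second splice merges two of them and again leads to fewer
    crossings. A single clique is the trefoil word, the one of size 2 being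
    excluded by planarity.

    Planarity enters through the Euler formula in two ways: as a count of faces,
    and through the fact that every circulation on the edges is the coboundary of
    a function on the faces. The latter shows that a crossing interlaced with
    another one has four distinct corners. *)

(** * Orbits of permutations *)

(** The obstacle is that every intermediate word must be both planar and reduced. The two properties
    support each other: smoothing keeps the face count only if two opposite corners of the crossing
    lie in different faces, and this follows from planarity and the absence of isolated vertices
    before the step. For a splice nothing is known yet about the new word, so the same count is read
    backwards, and the two corners are separated by exhibiting a short face. As [kstep] is
    symmetric, it suffices to link each good word to one with fewer crossings. All words share one
    finite type of labels [T]; a label out of use carries a dummy face, which turns the Euler
    formula into the constant count [#|T| + 2]. A descent step introduces at most two new crossings,
    hence the two spare labels asked for by [good_reach]. One criterion recurs: a vertex not
    adjacent to [c] but adjacent to all neighbours of [c] shows that [c] has no true twin. *)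

Section Orbits.
Variable D : finType.
Implicit Types (s : {perm D}) (B : {set D}).

Lemma mem_porbit1 s x : s x \in porbit s x.
Proof. by rewrite -[s]expg1 mem_porbit. Qed.

Lemma porbit_step s x : porbit s (s x) = porbit s x.
Proof. by apply/eqP; rewrite eq_porbit_mem mem_porbit1. Qed.

Lemma porbit_closed s (P : pred D) x :
  (forall y, P y -> P (s y)) -> P x -> forall y, y \in porbit s x -> P y.
Proof.
move=> cl Px y /porbitP[i ->]; rewrite permX.
by elim: i => //= i IH; apply: cl.
Qed.

Lemma porbit_invariant (R : eqType) s (f : D -> R) x y :
  (forall z, z \in porbit s x -> f (s z) = f z) -> y \in porbit s x -> f y = f x.
Proof.
move=> fs /porbitP[i ->]; elim: i => [|i IH]; first by rewrite perm1.
by rewrite expgSr permM fs ?IH // mem_porbit.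
Qed.

(** [z] is taken out of its cycle and becomes a fixed point. This allows face permutations of words
    with different crossings to be compared on one type. *)
Definition cut s z : {perm D} := (tperm (s^-1 z) z * s)%g.

Lemma cutE s z x : cut s z x = if x == z then z else if s x == z then s z else s x.
Proof.
rewrite /cut permM; case: tpermP => [->|->|/eqP h1 /eqP h2].
- by rewrite permKV eqxx; case: eqP => // h; rewrite -{1}h permKV.
- by rewrite permKV eqxx.
- rewrite (negbTE h2); case: eqP => // h; case/eqP: h1.
  by apply: (@perm_inj _ s); rewrite permKV.
Qed.

Lemma card_cut s z : s z != z -> #|porbits (cut s z)| = #|porbits s|.+1.
Proof.
move=> nz; have nz' : s^-1%g z != z.
  by apply: contraNneq nz => h; rewrite -{1}h permKV.
have := porbits_mul_tperm s (s^-1%g z) z; rewrite nz' /=.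
have -> : s^-1%g z \in porbit s z by rewrite -porbitV mem_porbit1.
by rewrite /= addn0 addn1.
Qed.

Fixpoint cuts s (C : seq D) : {perm D} := if C is z :: C' then cut (cuts s C') z else s.

(** A cycle never meets two points of [C] in a row, so one extra application of [s] jumps over each
    gap, and each cut splits a fixed point off a longer cycle. *)
Lemma cutsE s C : uniq C -> (forall z, z \in C -> s z \notin C) ->
  (forall x, cuts s C x = if x \in C then x else if s x \in C then s (s x) else s x)
  /\ #|porbits (cuts s C)| = #|porbits s| + size C.
Proof.
elim: C => [|z C IH] /=; first by rewrite addn0.
move=> /andP[zC uC] H.
have [|E K] := IH uC.
  by move=> y yC; have := H y; rewrite !inE yC orbT negb_or => /(_ isT) /andP[].
have szC := H z (mem_head _ _).
have Ez : cuts s C z = s z.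
  rewrite E (negbTE zC); move: szC; rewrite inE negb_or => /andP[_ /negbTE ->] //.
split; last first.
  rewrite card_cut ?K ?addnS // Ez.
  by move: szC; rewrite inE negb_or => /andP[].
move=> x; rewrite cutE Ez !inE; case: eqP => //= xz.
rewrite E; case xC: (x \in C); first by move/eqP/negbTE: xz => ->.
case: (eqVneq (s x) z) => /= sz.
  by rewrite sz (negbTE zC) eqxx.
case sxC: (s x \in C); last by rewrite (negbTE sz).
case: eqP => // h; have := H (s x); rewrite !inE sxC orbT h eqxx; by move/(_ isT).
Qed.

Lemma card_porbit_merge s x y : x \notin porbit s y ->
  #|porbits (s * tperm x y)%g|.+1 = #|porbits s|.
Proof.
move=> h; have nxy : x != y by apply: contraNneq h => ->; exact: porbit_id.
have E : (s * tperm x y)%g = (tperm x y * s^-1)^-1%g.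
  by rewrite invMg tpermV invgK.
rewrite E porbitsV; have := porbits_mul_tperm s^-1 x y.
rewrite porbitsV porbitV h nxy /=; lia.
Qed.

Lemma card_porbits_const s k : (forall x, #|porbit s x| = k) -> #|porbits s| * k = #|D|.
Proof.
move=> H.
have P : partition (porbits s) [set: D].
  apply/and3P; split.
  - apply/eqP/setP => x; rewrite inE; apply/bigcupP; exists (porbit s x); last exact: porbit_id.
    exact: imset_f.
  - apply/trivIsetP => A B /imsetP[x _ ->] /imsetP[y _ ->] nAB.
    rewrite -setI_eq0; apply/set0Pn => -[z]; rewrite inE => /andP[].
    by rewrite -!eq_porbit_mem => /eqP h1 /eqP h2; rewrite -h1 -h2 eqxx in nAB.
  - apply/imsetP => -[x _ /setP/(_ x)]; rewrite porbit_id inE //.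
by rewrite -cardsT (card_uniform_partition (n := k) _ P) // => A /imsetP[x _ ->].
Qed.

Lemma card_porbit2 s x : s (s x) = x -> s x != x -> #|porbit s x| = 2.
Proof.
move=> h1 h2; have -> : porbit s x = [set x; s x].
  apply/eqP; rewrite eqEsubset; apply/andP; split; apply/subsetP => y.
    apply: (porbit_closed (P := mem [set x; s x])); last by rewrite !inE eqxx.
    by move=> z; rewrite !inE => /orP[]/eqP->; rewrite ?h1 eqxx ?orbT.
  by rewrite !inE => /orP[]/eqP->; rewrite ?porbit_id ?mem_porbit1.
by rewrite cards2 eq_sym h2.
Qed.

Lemma mem_porbit4 s x : s (s (s (s x))) = x ->
  porbit s x =i [:: x; s x; s (s x); s (s (s x))].
Proof.
move=> h y; apply/idP/idP.
  apply: (porbit_closed (P := mem [:: x; s x; s (s x); s (s (s x))])); last exact: mem_head.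
  by move=> z /=; rewrite !inE => /or4P[]/eqP->; rewrite ?h eqxx ?orbT.
rewrite !inE => /or4P[]/eqP->; rewrite ?porbit_id ?mem_porbit1 //.
- by rewrite -[in X in _ \in X](porbit_step s x) mem_porbit1.
- by rewrite -[in X in _ \in X](porbit_step s x) -[in X in _ \in X](porbit_step s (s x)) mem_porbit1.
Qed.

Lemma uniq_orbit4 s x : s (s (s (s x))) = x -> s x != x -> s (s x) != x ->
  uniq [:: x; s x; s (s x); s (s (s x))].
Proof.
move=> h h1 h2; have i := @perm_inj _ s.
have h3 : s (s (s x)) != x.
  by apply: contra h1 => /eqP h3; rewrite -{2}h h3.
rewrite /= !inE !negb_or !(inj_eq i) andbT (eq_sym x (s x)) (eq_sym x (s (s x))).
by rewrite (eq_sym x (s (s (s x)))) h1 h2 h3.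
Qed.

Lemma card_porbit4 s x : s (s (s (s x))) = x -> s x != x -> s (s x) != x -> #|porbit s x| = 4.
Proof.
move=> h h1 h2; rewrite (eq_card (mem_porbit4 h)).
by rewrite (card_uniqP (uniq_orbit4 h h1 h2)).
Qed.

End Orbits.

Lemma porbit_imset (D D' : finType) (s : {perm D}) (s' : {perm D'}) (f : D' -> D) x :
  (forall x, f (s' x) = s (f x)) -> porbit s (f x) = f @: porbit s' x.
Proof.
move=> fs; apply/setP => y; apply/porbitP/imsetP.
  move=> [i ->]; exists ((s' ^+ i)%g x); first exact: mem_porbit.
  by rewrite !permX; elim: i => //= i ->; rewrite fs.
move=> [z /porbitP[i ->] ->]; exists i.
by rewrite !permX; elim: i => //= i IH; rewrite fs IH.
Qed.

Lemma card_porbits_imset (D D' : finType) (s : {perm D}) (s' : {perm D'}) (f : D' -> D) :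
  injective f -> (forall x, f (s' x) = s (f x)) ->
  #|porbits s'| = #|[set porbit s (f x) | x : D']|.
Proof.
move=> fi fs.
have <- : [set f @: O | O : {set D'} in porbits s'] = [set porbit s (f x) | x : D'].
  apply/setP => O; apply/imsetP/imsetP.
    by move=> [O' /imsetP[x _ ->] ->]; exists x => //; rewrite (porbit_imset x fs).
  by move=> [x _ ->]; exists (porbit s' x); [exact: imset_f|rewrite (porbit_imset x fs)].
by rewrite card_imset //; exact: imset_inj.
Qed.

Lemma card_porbits_conj (D : finType) (s s' : {perm D}) (f : D -> D) :
  injective f -> (forall x, f (s' x) = s (f x)) -> #|porbits s'| = #|porbits s|.
Proof.
move=> fi fs; rewrite (card_porbits_imset fi fs); congr #|pred_of_set _|.
apply/setP => O; apply/imsetP/imsetP => -[x _ ->].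
  by exists (f x).
by exists (invF fi x); rewrite ?f_invF.
Qed.

(** * Potentials on spherical maps *)

Section Potential.
Local Open Scope ring_scope.
Variable D : finType.
Local Notation n := #|D|.
Local Notation ev := (@enum_val D D).
Implicit Types (s : {perm D}) (h : D -> rat).

Definition fun_row h : 'rV[rat]_n := \row_i h (ev i).
(** The operator 1 - s; its row space consists of the functions with zero sum on each cycle of
    [s]. *)
Definition diff_mx s : 'M[rat]_n := \matrix_(i, j) ((ev i == ev j)%:R - (s (ev i) == ev j)%:R).

Definition dirac_row x : 'rV[rat]_n := fun_row (fun y => (y == x)%:R).

Lemma sum_ev (F : D -> rat) : \sum_(i < n) F (ev i) = \sum_x F x.
Proof. by rewrite -(big_enum_val (A := D)). Qed.

Lemma sum_delta (F : D -> rat) y : \sum_x F x * (x == y)%:R = F y.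
Proof.
rewrite (bigD1 y) //= eqxx mulr1 big1 ?addr0 // => x /negbTE ->.
by rewrite mulr0.
Qed.

Lemma fun_row_diff h s : fun_row h *m diff_mx s = fun_row (fun y => h y - h (s^-1%g y)).
Proof.
apply/rowP => j; rewrite !mxE.
under eq_bigr do rewrite !mxE.
rewrite (sum_ev (fun x => h x * ((x == ev j)%:R - (s x == ev j)%:R))).
under eq_bigr do rewrite mulrBr.
rewrite big_split /= sum_delta sumrN; congr (_ - _).
rewrite -sum_delta; apply: eq_bigr => x _.
by rewrite (can2_eq (permK s) (permKV s)).
Qed.

Lemma fun_row_diffT h s : fun_row h *m (diff_mx s)^T = fun_row (fun y => h y - h (s y)).
Proof.
apply/rowP => j; rewrite !mxE.
under eq_bigr do rewrite !mxE.
rewrite (sum_ev (fun x => h x * ((ev j == x)%:R - (s (ev j) == x)%:R))).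
under eq_bigr do rewrite mulrBr.
rewrite big_split /= sumrN.
under eq_bigr do rewrite eq_sym.
by under [X in _ - X]eq_bigr do rewrite eq_sym; rewrite !sum_delta.
Qed.

Lemma fun_rowE (u : 'rV[rat]_n) : exists h, u = fun_row h.
Proof.
exists (fun x => u 0 (enum_rank x)); apply/rowP => j.
by rewrite !mxE enum_valK.
Qed.

Definition orbit_mx s : 'M[rat]_(n, #|porbits s|) :=
  \matrix_(i, k) (ev i \in (enum_val k : {set D}))%:R.

Lemma porbit_enum s (k : 'I_#|porbits s|) : exists x, enum_val k = porbit s x.
Proof. by have /imsetP[x _ ->] := enum_valP k; exists x. Qed.

Lemma rank_orbit_mx s : \rank (orbit_mx s) = #|porbits s|.
Proof.
apply/eqP; rewrite eqn_leq rank_leq_col /=.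
have H (k : 'I_#|porbits s|) : exists i, ev i \in (enum_val k : {set D}).
  have [x ->] := porbit_enum k; exists (enum_rank x).
  by rewrite enum_rankK porbit_id.
pose rep k := xchoose (H k).
have repP k : ev (rep k) \in (enum_val k : {set D}) := xchooseP (H k).
rewrite -[X in (X <= _)%N](mxrank1 rat).
suff <- : rowsub rep (orbit_mx s) = 1%:M by exact: mxrankS (rowsub_sub _ _).
apply/matrixP => k l; rewrite !mxE; congr (_%:R); congr (nat_of_bool _).
apply/idP/eqP => [|<-]; last exact: repP.
have := repP k; have [x ek] := porbit_enum k; have [y el] := porbit_enum l.
rewrite ek el -!eq_porbit_mem => /eqP hx /eqP hy.
by apply: enum_val_inj; rewrite ek el -hx -hy.
Qed.

Lemma diff_orbit_mx s : diff_mx s *m orbit_mx s = 0.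
Proof.
apply/matrixP => i k; rewrite !mxE.
under eq_bigr do rewrite !mxE.
have [x ek] := porbit_enum k; rewrite ek.
rewrite (sum_ev (fun z => ((ev i == z)%:R - (s (ev i) == z)%:R) * (z \in porbit s x)%:R)).
under eq_bigr do rewrite mulrC mulrBr.
rewrite big_split /= sumrN.
under eq_bigr do rewrite eq_sym.
under [X in _ - X]eq_bigr do rewrite eq_sym.
rewrite !(sum_delta (fun z => (z \in porbit s x)%:R)).
by rewrite -!eq_porbit_mem porbit_step subrr.
Qed.

Lemma rank_diff_mx s : (\rank (diff_mx s) + #|porbits s| <= n)%N.
Proof. by rewrite -(rank_orbit_mx s); exact: mulmx0_rank_max (diff_orbit_mx s). Qed.

Variables s a : {perm D}.
Hypothesis a2 : forall x, a (a x) = x.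
Hypothesis conn : forall x y, connect (fun u v => (v == s u) || (v == a u)) x y.
Local Notation phi := (a * s)%g.

Lemma invariant_constant h : (forall x, h (s x) = h x) -> (forall x, h (a x) = h x) ->
  forall x y, h x = h y.
Proof.
move=> hs ha x y; have /connectP[p pp ->] := conn x y.
elim: p x pp => //= z p IH x /andP[/orP[]/eqP-> pp]; rewrite -IH //.
Qed.

(** Along a path of the map a Dirac function changes by elements of the two row spaces. By
    connectivity one Dirac generates everything modulo their sum, whose codimension is thus at most
    one. *)
Lemma rank_sum (x0 : D) : (n <= \rank (diff_mx s + diff_mx a)%MS + 1)%N.
Proof.
pose V := ((diff_mx s + diff_mx a) + dirac_row x0)%MS.
have dV x : (dirac_row x <= V)%MS.
  have /connectP[p pp ->] := conn x0 x.
  have: (dirac_row x0 <= V)%MS by exact: addsmxSr.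
  have st (t : {perm D}) u : (diff_mx t <= V)%MS -> (dirac_row u <= V)%MS ->
      (dirac_row (t u) <= V)%MS.
    move=> h1 h2.
    have -> : dirac_row (t u) =
        dirac_row u - dirac_row u *m diff_mx t.
      rewrite /dirac_row fun_row_diff; apply/rowP => j; rewrite !mxE opprB addrCA subrr addr0.
      by rewrite (can2_eq (permKV t) (permK t)).
    by rewrite addmx_sub // eqmx_opp (submx_trans (submxMl _ _)).
  have Vs : (diff_mx s <= V)%MS by exact: submx_trans (addsmxSl _ _) (addsmxSl _ _).
  have Va : (diff_mx a <= V)%MS by exact: submx_trans (addsmxSr _ _) (addsmxSl _ _).
  elim: p {V Vs Va}x0 pp (V) st Vs Va => //= z p IH y /andP[hz pp] V st Vs Va hy.
  by apply: (IH z) => //; case/orP: hz => /eqP ->; apply: st.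
have fV : row_full V.
  rewrite -sub1mx; apply/row_subP => i.
  apply: submx_trans (dV (ev i)); apply/eq_row_sub.
  instantiate (1 := 0); apply/rowP => j; rewrite !mxE eq_sym.
  by rewrite (inj_eq enum_val_inj).
move/eqP: fV => fV; have [le _] := mxrank_adds_leqif (diff_mx s + diff_mx a)%MS (dirac_row x0).
have := rank_leq_row (dirac_row x0); rewrite -/V fV in le; lia.
Qed.

(** A dimension count. With V, E, F the numbers of cycles of [s], [a], [phi] and n = 2E, the two row
    spaces meet in dimension at most (n - V) + (n - E) - (n - 1) = F - 1, by the Euler formula. The
    differences [f x - f (s x)] with [f] constant on faces lie in this intersection; only constants
    give zero, so they have dimension at least F - 1 and fill it. *)
Lemma potential g : (0 < n)%N ->
  (#|porbits s| + #|porbits phi| = #|porbits a| + 2)%N -> (#|porbits a| * 2 = n)%N ->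
  (exists h, fun_row g = fun_row h *m diff_mx s) -> (exists h, fun_row g = fun_row h *m diff_mx a) ->
  exists f, (forall x, f (phi x) = f x) /\ forall x, g x = f x - f (s x).
Proof.
move=> n0 euler ea [h1 gs] [h2 ga].
pose B := (orbit_mx phi)^T *m (diff_mx s)^T.
have invphi u : (u <= (orbit_mx phi)^T)%MS -> exists2 f, u = fun_row f & forall x, f (phi x) = f x.
  case/submxP => c ->; have [f e] := fun_rowE (c *m (orbit_mx phi)^T); exists f => // x.
  have E y : f y = \sum_k c 0 k * (y \in (enum_val k : {set D}))%:R.
    have /rowP/(_ (enum_rank y)) := e; rewrite !mxE enum_rankK => <-.
    by apply: eq_bigr => k _; rewrite !mxE enum_rankK.
  rewrite !E; apply: eq_bigr => k _; have [z ->] := porbit_enum k.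
  by rewrite -!eq_porbit_mem porbit_step.
have phiE f : (forall x, f (phi x) = f x :> rat) -> forall x, f (s x) = f (a x).
  by move=> hf x; rewrite -[RHS]hf permM a2.
(* Constancy on faces means [f (s x) = f (a x)], so a difference along [s] is also one along [a]. *)
have BM : (B <= diff_mx s :&: diff_mx a)%MS.
  apply/row_subP => k; rewrite row_mul.
  have [f -> hf] := invphi (row k (orbit_mx phi)^T) (row_sub _ _).
  rewrite fun_row_diffT sub_capmx; apply/andP; split; apply/submxP.
    exists (fun_row (fun x => - f (s x))); rewrite fun_row_diff; apply/rowP => j; rewrite !mxE permKV.
    by rewrite opprK addrC.
  exists (fun_row (fun x => - f (a x))); rewrite fun_row_diff; apply/rowP => j; rewrite !mxE permKV.
  by rewrite opprK addrC phiE.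
have rB : (#|porbits phi| <= \rank B + 1)%N.
  have e1 := mxrank_mul_ker (orbit_mx phi)^T (diff_mx s)^T.
  rewrite mxrank_tr rank_orbit_mx -/B in e1; rewrite -[X in (X <= _)%N]e1 leq_add2l.
  suff H : ((orbit_mx phi)^T :&: kermx (diff_mx s)^T <= fun_row (fun _ => 1))%MS.
    exact: leq_trans (mxrankS H) (rank_leq_row _).
  apply/row_subP => k; move: (row_sub k ((orbit_mx phi)^T :&: kermx (diff_mx s)^T)%MS).
  move: (row _ _) => u; rewrite sub_capmx => /andP[/invphi[f -> hf]].
  move/sub_kermxP; rewrite fun_row_diffT => /rowP e.
  have es x : f (s x) = f x.
    by have := e (enum_rank x); rewrite !mxE enum_rankK => /eqP; rewrite subr_eq0 => /eqP.
  have ea' x : f (a x) = f x by rewrite -phiE.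
  have [x0 _] : exists x0, x0 \in D by apply/card_gt0P.
  apply/submxP; exists (const_mx (f x0)); apply/rowP => j.
  by rewrite !mxE big_ord1 !mxE mulr1; apply: invariant_constant.
have gB : (fun_row g <= B)%MS.
  have gI : (fun_row g <= diff_mx s :&: diff_mx a)%MS.
    by rewrite sub_capmx {1}gs ga !submxMl.
  have [x0 _] : exists x0, x0 \in D by apply/card_gt0P.
  have le1 := mxrankS BM.
  have h3 := rank_diff_mx s; have h4 := rank_diff_mx a; have h5 := rank_sum x0.
  have h6 := mxrank_sum_cap (diff_mx s) (diff_mx a).
  have : (\rank (diff_mx s :&: diff_mx a)%MS <= \rank B)%N by lia.
  move=> le2; apply: submx_trans gI _.
  by rewrite -(mxrank_leqif_sup BM).2 eqn_leq le1 le2.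
case/submxP: gB => c; rewrite mulmxA.
have [f -> hf] := invphi (c *m (orbit_mx phi)^T) (submxMl _ _).
rewrite fun_row_diffT => /rowP e; exists f; split=> // x.
by have := e (enum_rank x); rewrite !mxE enum_rankK.
Qed.

End Potential.

Lemma kproj_cards (p : kproj) :
  #|porbits (ksig p)| * 4 = #|kd p| /\ #|porbits (kalp p)| * 2 = #|kd p|.
Proof.
split; apply: card_porbits_const => x.
  by have [h1 [h2 h3]] := kproj_deg4 x; apply: card_porbit4.
by have [h1 h2] := kproj_edge x; apply: card_porbit2.
Qed.

Lemma kproj_potential (p : kproj) (g : kd p -> rat) :
  (forall x, g (kalp p x) = - g x)%R ->
  (forall x, g x + g (ksig p x) + g (ksig p (ksig p x)) + g (ksig p (ksig p (ksig p x))) = 0)%R ->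
  exists f : kd p -> rat, (forall x, f (kphi p x) = f x) /\
    (forall x, g x = f x - f (ksig p x))%R.
Proof.
move=> ga gs; have [c4 c2] := kproj_cards p.
apply: potential => //.
- by move=> x; have [] := kproj_edge x.
- exact: kproj_conn.
- exact: kproj_nonempty.
- exact: kproj_sphere.
- (* inverts [1 - s] on functions with zero sum over each 4-cycle *)
  pose s := ksig p.
  exists (fun x => 4^-1 * g x - 2^-1 * g (s x) - 4^-1 * g (s (s x)))%R.
  rewrite fun_row_diff; apply/rowP => j; rewrite !mxE; set x := enum_val j.
  have e : (s^-1)%g x = s (s (s x)).
    by apply: (@perm_inj _ s); rewrite permKV; have [-> _] := kproj_deg4 x.
  rewrite e; have [e4 _] := kproj_deg4 x; rewrite -/s in e4.
  have := gs x; rewrite -/s e4 => h; lra.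
- exists (fun x => 2^-1 * g x)%R; rewrite fun_row_diff; apply/rowP => j; rewrite !mxE.
  set x := enum_val j; have -> : ((kalp p)^-1)%g x = kalp p x.
    by apply: (@perm_inj _ (kalp p)); rewrite permKV; have [->] := kproj_edge x.
  rewrite ga; lra.
Qed.

(** * Signed Gauss words *)

Section Adjacency.
Variable L : eqType.
Implicit Types (l m : L) (w A B : seq L).

Lemma next_catC A B : uniq (A ++ B) -> next (A ++ B) =1 next (B ++ A).
Proof. by move=> u x; rewrite -(rot_size_cat A B) next_rot. Qed.

Lemma adj_cat A l m B : uniq (A ++ l :: m :: B) ->
  next (A ++ l :: m :: B) l = m /\ prev (A ++ l :: m :: B) m = l.
Proof.
move=> u; have e : next (A ++ l :: m :: B) l = m.
  by rewrite next_catC //= eqxx.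
by split=> //; have := prev_next u l; rewrite e.
Qed.

Lemma adj_last m A : uniq (m :: A) ->
  next (m :: A) (last m A) = m /\ prev (m :: A) m = last m A.
Proof.
move=> u; have e : next (m :: A) (last m A) = m.
  case/lastP: A u => [|A l] u; first by rewrite /= eqxx.
  by rewrite last_rcons -cats1 -cat_cons next_catC /= ?eqxx // cats1.
by split=> //; have := prev_next u (last m A); rewrite e.
Qed.

Lemma mem_split w l : l \in w -> exists A B, w = A ++ l :: B.
Proof. by case/splitPr => A B; exists A, B. Qed.

Lemma next_notin w l : l \notin w -> next w l = l.
Proof. by move=> h; rewrite next_nth (negbTE h). Qed.

Lemma prev_notin w l : l \notin w -> prev w l = l.
Proof. by move=> h; rewrite prev_nth (negbTE h). Qed.

Lemma fconnect_next w : uniq w -> {in w &, forall x y, exists k, iter k (next w) x = y}.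
Proof.
move=> u x y xw yw; have [i s' e] := rot_to xw.
have us : uniq (x :: s') by rewrite -e rot_uniq.
have E z : next w z = next (x :: s') z by rewrite -e next_rot.
have ys : y \in x :: s' by rewrite -e mem_rot.
have c := cycle_next us.
have : path (frel (next (x :: s'))) x s'.
  by move: c; rewrite /= rcons_path => /andP[].
move/fpathP => [k es]; have : y \in traject (next (x :: s')) x (size s').+1.
  have -> : size s' = k by rewrite {1}es size_traject.
  by rewrite trajectS -es.
case/trajectP => j _ ->; exists j.
by elim: j => //= j ->; rewrite E.
Qed.

End Adjacency.

Section PermOfFun.
Variable D : finType.

(** The identity is a fallback, so that [wphi] makes sense for every word without a uniqueness proof
    in its definition. *)
Definition perm_of_fun (f : D -> D) : {perm D} :=
  if @idP (injectiveb f) is ReflectT h then perm (elimT (injectiveP f) h) else 1%g.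

Lemma perm_of_funE f : injective f -> perm_of_fun f =1 f.
Proof.
move=> fi x; rewrite /perm_of_fun; case: {-}_ / idP => [h|[]]; first by rewrite permE.
exact/injectiveP.
Qed.

End PermOfFun.

Section Words.
Variable T : finType.
Implicit Types (l m c : T * bool) (w X Y : seq (T * bool)) (d : T * bool * bool) (u v : T).

Definition bar l : T * bool := (l.1, ~~ l.2).

(* A dart is a letter (a passage of the curve through a crossing) with a flag
   telling whether it points out of the crossing. The strand of [(v, true)] is
   crossed from left to right by the strand of [(v, false)], so that the darts
   at [v] are met counterclockwise in the order out-true, in-false, in-true,
   out-false. *)
Definition dsig d : T * bool * bool := (bar d.1, d.1.2 (+) d.2).
Definition dalp w d : T * bool * bool :=
  if d.2 then (next w d.1, false) else (prev w d.1, true).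
Definition dphi w d := dsig (dalp w d).
Definition wphi w : {perm T * bool * bool} := perm_of_fun (dphi w).

Definition wf w := uniq w && all (fun l => bar l \in w) w.

Lemma dalp_out w l : dalp w (l, true) = (next w l, false). Proof. by []. Qed.

Lemma dalp_in w l : dalp w (l, false) = (prev w l, true). Proof. by []. Qed.

Lemma barK : involutive bar.
Proof. by case=> u b; rewrite /bar /= negbK. Qed.

Lemma bar_neq l : bar l != l.
Proof. by case: l => u []; rewrite /bar /= xpair_eqE eqxx. Qed.

Lemma same_label l m : l.1 = m.1 -> m = l \/ m = bar l.
Proof. by case: l m => u [] [v []] /= ->; rewrite /bar /=; auto. Qed.

Lemma dsig_inj : injective dsig.
Proof.
move=> [[u b] o] [[v b'] o']; rewrite /dsig /bar /=.
by case: b; case: b'; case: o; case: o' => // -[->].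
Qed.

Lemma dsig4 d : dsig (dsig (dsig (dsig d))) = d.
Proof. by case: d => [[u []] []]. Qed.

Lemma dalpK w : uniq w -> involutive (dalp w).
Proof.
move=> uw [l []]; rewrite /dalp /=; first by rewrite prev_next.
by rewrite next_prev.
Qed.

Lemma dphi_inj w : uniq w -> injective (dphi w).
Proof. by move=> uw; apply: inj_comp; [exact: dsig_inj | exact: inv_inj (dalpK uw)]. Qed.

Lemma wphiE w : uniq w -> wphi w =1 dphi w.
Proof. by move=> uw; apply: perm_of_funE; exact: dphi_inj. Qed.

Lemma wf_uniq w : wf w -> uniq w. Proof. by case/andP. Qed.

Lemma wf_bar w l : wf w -> (bar l \in w) = (l \in w).
Proof.
case/andP=> _ /allP h; apply/idP/idP => [/h|/h] //=.
by rewrite barK.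
Qed.

Lemma wf_rot i w : wf (rot i w) = wf w.
Proof.
rewrite /wf rot_uniq (eq_all_r (mem_rot i w)); congr (_ && _).
by apply: eq_all => l /=; rewrite mem_rot.
Qed.

Lemma dalp_rot i w : uniq w -> dalp (rot i w) =1 dalp w.
Proof. by move=> uw [l []]; rewrite /dalp /= ?next_rot ?prev_rot. Qed.

Lemma wphi_rot i w : uniq w -> wphi (rot i w) = wphi w.
Proof.
by move=> uw; apply/permP => d; rewrite !wphiE ?rot_uniq // /dphi dalp_rot.
Qed.

(* [w = c X c' Y] becomes [X^-1 Y] when the crossing of [c] is smoothed; the
   strand of [X] is reversed, which exchanges the signs of the crossings that
   are met once by [X]. *)
Definition oddX X u := ((u, true) \in X) (+) ((u, false) \in X).
Definition tog X l : T * bool := (l.1, l.2 (+) oddX X l.1).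
Definition flip X Y := map (tog X) (rev X ++ Y).
(** Identifies the darts before and after smoothing. The arc [X] is traversed backwards, which
    exchanges in and out on its letters; together with [tog] this preserves the rotation at each
    crossing. *)
Definition theta X d : T * bool * bool := (tog X d.1, d.2 (+) (d.1 \in X)).

Lemma tog_inj X : injective (tog X).
Proof. by move=> [u b] [v b']; rewrite /tog /= => -[-> /addIb ->]. Qed.

Lemma theta_inj X : injective (theta X).
Proof.
move=> [l o] [m o'] h; have /tog_inj /= e := congr1 fst h.
by have := congr1 snd h; rewrite /theta /= e => /addIb ->.
Qed.

Lemma theta_sig X d : theta X (dsig d) = dsig (theta X d).
Proof.
case: d => [[u b] o]; rewrite /theta /dsig /bar /tog /oddX /=.
by case: b; case: o; case: ((u, true) \in X); case: ((u, false) \in X).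
Qed.

(** A strand arriving at [c] continues from the dart of the other passage with the same flag.
    Joining in with in and out with out is the smoothing against the orientation. *)
Definition skip w c d := if d.1.1 == c.1 then dalp w (bar d.1, d.2) else d.

Section Smooth.
Variables (c : T * bool) (X Y : seq (T * bool)).
Let w := c :: X ++ bar c :: Y.
Hypothesis (wfw : wf w) (X0 : X != [::]) (Y0 : Y != [::]).

Lemma smooth_uniq : uniq (rev X ++ Y).
Proof.
have := wf_uniq wfw; rewrite /w /= !cat_uniq rev_uniq /= => /and3P[_ -> /and3P[]].
rewrite negb_or => /andP[_ /negbTE h] _ ->; rewrite andbT.
by rewrite (eq_has (mem_rev X)) h.
Qed.

Lemma notin_smooth : [/\ c \notin X, c \notin Y, bar c \notin X & bar c \notin Y].
Proof.
have := wf_uniq wfw; rewrite /w /= mem_cat !inE !negb_or cat_uniq /= negb_or.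
by case/and4P => /and3P[-> _ ->] _ /andP[-> _] /andP[-> _].
Qed.

Lemma smooth_label l : l \in rev X ++ Y -> l.1 != c.1.
Proof.
have [h1 h2 h3 h4] := notin_smooth; rewrite mem_cat mem_rev => h; apply/eqP => e.
by have [e'|e'] := same_label (esym e); move: h; rewrite e' => /orP[]; apply/negP.
Qed.

Lemma in_smooth l : (l \in w) = (l.1 == c.1) || (l \in rev X ++ Y).
Proof.
rewrite /w inE mem_cat inE mem_cat mem_rev; case: (eqVneq l.1 c.1) => [e|ne] /=.
  by have [->|->] := same_label (esym e); rewrite eqxx ?orbT.
case: eqP => [h|_ /=]; first by rewrite h eqxx in ne.
by case: eqP => [h|_ //]; rewrite h /= eqxx in ne.
Qed.

(** Only edges at the first or last letter of [X] or [Y] lead to [c], and [skip] reconnects exactly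
    these. The cases are the arc of the letter, the flag, and whether the letter ends its arc. *)
Lemma dalp_smooth d : d.1 \in rev X ++ Y ->
  dalp (flip X Y) (theta X d) = theta X (skip w c (dalp w d)).
Proof.
have us := smooth_uniq; have [h1 h2 h3 h4] := notin_smooth.
have uw := wf_uniq wfw.
have Ec l : l \in rev X ++ Y -> forall o, skip w c (l, o) = (l, o).
  by move=> h o; rewrite /skip /= (negbTE (smooth_label h)).
have Ecc o : skip w c (c, o) = dalp w (bar c, o) by rewrite /skip /= eqxx.
have Ecb o : skip w c (bar c, o) = dalp w (c, o) by rewrite /skip /= eqxx barK.
have D m : (dalp (flip X Y) (tog X m, true) = (tog X (next (rev X ++ Y) m), false))
    * (dalp (flip X Y) (tog X m, false) = (tog X (prev (rev X ++ Y) m), true)).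
  by rewrite /dalp /flip /= next_map ?prev_map //; apply: tog_inj.
have XY l : l \in X -> l \notin Y.
  move=> lX; move: us; rewrite cat_uniq => /and3P[_ /hasPn h _].
  by apply/negP => /h; rewrite /= mem_rev lX.
have YX l : l \in Y -> l \notin X by move=> lY; apply/negP => /XY; rewrite lY.
have tX m : m \in X ->
    (theta X (m, true) = (tog X m, false)) * (theta X (m, false) = (tog X m, true)).
  by move=> h; rewrite /theta /= h.
have tY m o : m \notin X -> theta X (m, o) = (tog X m, o).
  by move=> h; rewrite /theta /= (negbTE h) addbF.
have [y [Y' eY]] : exists y Y', Y = y :: Y' by case: (Y) Y0 => // y Y'; exists y, Y'.
have [x [X' eX]] : exists x X', X = x :: X' by case: (X) X0 => // x X'; exists x, X'.
have yY : y \in Y by rewrite eY mem_head.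
have xX : x \in X by rewrite eX mem_head.
have lY : last y Y' \in Y by rewrite eY mem_last.
have lX : last x X' \in X by rewrite eX mem_last.
have inX m : m \in X -> m \in rev X ++ Y by rewrite mem_cat mem_rev => ->.
have inY m : m \in Y -> m \in rev X ++ Y by rewrite mem_cat mem_rev orbC => ->.
have pc : prev w c = last y Y'.
  by have [_ ->] := adj_last uw; rewrite last_cat eY.
have nc : next w c = x.
  have e : w = [::] ++ c :: x :: (X' ++ bar c :: Y) by rewrite /w eX.
  by rewrite e; have [] := @adj_cat _ [::] c x (X' ++ bar c :: Y); rewrite -?e.
have nb : next w (bar c) = y.
  have e : w = (c :: X) ++ bar c :: y :: Y' by rewrite /w eY.
  by rewrite e; have [] := @adj_cat _ (c :: X) (bar c) y Y'; rewrite -?e.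
have pb : prev w (bar c) = last x X'.
  have e : w = (c :: belast x X') ++ last x X' :: bar c :: Y.
    by rewrite /w eX (lastI x X') cat_rcons.
  by rewrite e; have [] := @adj_cat _ (c :: belast x X') (last x X') (bar c) Y; rewrite -?e.
case: d => l o; rewrite [_.1]/= mem_cat mem_rev => /orP[] hl.
  have [X1 [X2 eX12]] := mem_split hl.
  have ev : rev X ++ Y = rev X2 ++ l :: rev X1 ++ Y.
    by rewrite eX12 rev_cat rev_cons cat_rcons -catA.
  case: o.
    rewrite dalp_out tX // D.
    case: X2 eX12 ev => [|m X2] eX12 ev.
      have -> : next w l = bar c.
        have e : w = (c :: X1) ++ l :: bar c :: Y by rewrite /w eX12 -catA.
        by rewrite e; have [] := @adj_cat _ (c :: X1) l (bar c) Y; rewrite -?e.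
      rewrite Ecb dalp_in pc tY ?YX //; congr (tog X _, _).
      have e : rev X ++ Y = l :: (rev X1 ++ Y) by rewrite ev.
      have := @adj_last _ l (rev X1 ++ Y); rewrite -e => /(_ us)[_ ->].
      by rewrite last_cat eY.
    have mX : m \in X by rewrite eX12 mem_cat !inE eqxx !orbT.
    have -> : next w l = m.
      have e : w = (c :: X1) ++ l :: m :: (X2 ++ bar c :: Y) by rewrite /w eX12 -catA.
      by rewrite e; have [] := @adj_cat _ (c :: X1) l m (X2 ++ bar c :: Y); rewrite -?e.
    rewrite Ec ?inX // tX //; congr (tog X _, _).
    rewrite rev_cons cat_rcons in ev; rewrite ev.
    by have [] := @adj_cat _ (rev X2) m l (rev X1 ++ Y); rewrite -?ev.
  rewrite dalp_in tX // D.
  case/lastP: X1 eX12 ev => [|X1 m] eX12 ev.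
    have exl : x = l by move: eX12; rewrite eX => -[].
    have -> : prev w l = c by rewrite -exl -nc prev_next.
    rewrite Ecc dalp_out nb tY ?YX //; congr (tog X _, _).
    rewrite ev /= eY.
    by have [] := @adj_cat _ (rev X2) l y Y'; rewrite -1?eY -?ev.
  have mX : m \in X by rewrite eX12 mem_cat mem_rcons !inE eqxx.
  have -> : prev w l = m.
    have e : w = (c :: X1) ++ m :: l :: (X2 ++ bar c :: Y) by rewrite /w eX12 -catA cat_rcons.
    by rewrite e; have [] := @adj_cat _ (c :: X1) m l (X2 ++ bar c :: Y); rewrite -?e.
  rewrite Ec ?inX // tX //; congr (tog X _, _).
  rewrite rev_rcons cat_cons in ev; rewrite ev.
  by have [] := @adj_cat _ (rev X2) l m (rev X1 ++ Y); rewrite -?ev.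
have [Y1 [Y2 eY12]] := mem_split hl.
case: o.
  rewrite dalp_out tY ?YX // D.
  case: Y2 eY12 => [|m Y2] eY12.
    have el : l = last y Y' by rewrite -(last_cons y y) -eY eY12 last_cat.
    have -> : next w l = c by rewrite el -pc next_prev.
    rewrite Ecc dalp_in pb tX //; congr (tog X _, _).
    have e : rev X ++ Y = last x X' :: (rev (belast x X') ++ Y1 ++ [:: l]).
      by rewrite eY12 eX lastI rev_rcons.
    have := @adj_last _ (last x X') (rev (belast x X') ++ Y1 ++ [:: l]).
    by rewrite -e !last_cat /= => -[].
  have mY : m \in Y by rewrite eY12 mem_cat !inE eqxx !orbT.
  have -> : next w l = m.
    have e : w = (c :: X ++ bar c :: Y1) ++ l :: m :: Y2 by rewrite /w eY12 /= -catA.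
    by rewrite e; have [] := @adj_cat _ (c :: X ++ bar c :: Y1) l m Y2; rewrite -?e.
  rewrite Ec ?inY // tY ?YX //; congr (tog X _, _).
  have e : rev X ++ Y = (rev X ++ Y1) ++ l :: m :: Y2 by rewrite eY12 catA.
  by rewrite e; have [] := @adj_cat _ (rev X ++ Y1) l m Y2; rewrite -?e.
rewrite dalp_in tY ?YX // D.
case/lastP: Y1 eY12 => [|Y1 m] eY12.
  have eyl : y = l by move: eY12; rewrite eY => -[].
  have -> : prev w l = bar c by rewrite -eyl -nb prev_next.
  rewrite Ecb dalp_out nc tX //; congr (tog X _, _).
  have e : rev X ++ Y = rev X' ++ x :: l :: Y2 by rewrite eX eY12 rev_cons cat_rcons.
  by rewrite e; have [] := @adj_cat _ (rev X') x l Y2; rewrite -?e.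
have mY : m \in Y by rewrite eY12 mem_cat mem_rcons !inE eqxx.
have -> : prev w l = m.
  have e : w = (c :: X ++ bar c :: Y1) ++ m :: l :: Y2 by rewrite /w eY12 /= -catA cat_rcons.
  by rewrite e; have [] := @adj_cat _ (c :: X ++ bar c :: Y1) m l Y2; rewrite -?e.
rewrite Ec ?inY // tY ?YX //; congr (tog X _, _).
have e : rev X ++ Y = (rev X ++ Y1) ++ m :: l :: Y2 by rewrite eY12 -catA cat_rcons.
by rewrite e; have [] := @adj_cat _ (rev X ++ Y1) m l Y2; rewrite -?e.
Qed.

End Smooth.
End Words.

(** * Face count under smoothing *)

Section Count.
Variable T : finType.
Implicit Types (l m c : T * bool) (w X Y : seq (T * bool)) (d : T * bool * bool) (u v : T).

Section Smooth.
Variables (c : T * bool) (X Y : seq (T * bool)).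
Let w := c :: X ++ bar c :: Y.
Hypothesis (wfw : wf w) (X0 : X != [::]) (Y0 : Y != [::]).

(** With both arcs nonempty no edge joins [c] to itself, so a single [skip] always leaves the
    crossing. *)
Lemma dalp_center d : d.1.1 = c.1 -> (dalp w d).1 \in rev X ++ Y.
Proof.
have uw := wf_uniq wfw.
have [y [Y' eY]] : exists y Y', Y = y :: Y' by case: (Y) Y0 => // y Y'; exists y, Y'.
have [x [X' eX]] : exists x X', X = x :: X' by case: (X) X0 => // x X'; exists x, X'.
case: d => l o /= /esym /same_label[] ->; case: o; rewrite ?dalp_out ?dalp_in mem_cat mem_rev.
- have e : w = [::] ++ c :: x :: (X' ++ bar c :: Y) by rewrite /w eX.
  have [-> _] : next w c = x /\ true.
    by rewrite e; have [] := @adj_cat _ [::] c x (X' ++ bar c :: Y); rewrite -?e.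
  by rewrite eX mem_head.
- have [_ ->] := adj_last uw.
  by rewrite last_cat eY [last _ _]/= mem_last orbT.
- have e : w = (c :: X) ++ bar c :: y :: Y' by rewrite /w eY.
  have [-> _] : next w (bar c) = y /\ true.
    by rewrite e; have [] := @adj_cat _ (c :: X) (bar c) y Y'; rewrite -?e.
  by rewrite eY mem_head orbT.
- have e : w = (c :: belast x X') ++ last x X' :: bar c :: Y.
    by rewrite /w eX (lastI x X') cat_rcons.
  have [-> _] : prev w (bar c) = last x X' /\ true.
    by rewrite e; have [] := @adj_cat _ (c :: belast x X') (last x X') (bar c) Y; rewrite -?e.
  by rewrite eX mem_last.
Qed.

Lemma oddX_notin u : (u, true) \notin X -> (u, false) \notin X -> oddX X u = false.
Proof. by move=> h1 h2; rewrite /oddX (negbTE h1) (negbTE h2). Qed.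

Lemma theta_out d : d.1 \notin rev X ++ Y -> theta X d = d.
Proof.
case: d => [l o]; rewrite mem_cat mem_rev negb_or => /= /andP[lX lY].
have lbX : bar l \notin X.
  apply/negP => h; have : bar l \in w by rewrite /w inE mem_cat h orbT.
  rewrite wf_bar // /w inE mem_cat inE (negbTE lX) (negbTE lY) orbF /=.
  have [h1 _ h2 _] := notin_smooth wfw.
  by case/orP=> /eqP e; move: h; rewrite e ?barK; apply/negP.
rewrite /theta /tog /= (negbTE lX) addbF oddX_notin; last 2 first.
- by case: (l) lX lbX => [u []].
- by case: (l) lX lbX => [u []].
by case: (l) => ? ?; rewrite addbF.
Qed.

Lemma mem_flip l : (tog X l \in flip X Y) = (l \in rev X ++ Y).
Proof. by rewrite /flip mem_map //; exact: tog_inj. Qed.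

Lemma flip_out l : l \notin rev X ++ Y -> l \notin flip X Y.
Proof.
move=> h; have e := congr1 fst (theta_out (d := (l, true)) h).
by rewrite /theta /= in e; rewrite -e mem_flip.
Qed.

Lemma flip_uniq : uniq (flip X Y).
Proof. by rewrite /flip map_inj_uniq ?(smooth_uniq wfw) //; exact: tog_inj. Qed.

Lemma dalp_flip_out d : d.1 \notin rev X ++ Y -> dalp (flip X Y) d = (d.1, ~~ d.2).
Proof.
by case: d => l [] /= h; rewrite /dalp /= ?next_notin ?prev_notin ?flip_out.
Qed.

(** Smoothing merges the faces at two opposite corners, distinct by hypothesis, while the label of
    [c] falls out of use and gains a dummy face. To compare the counts, the four darts of [c] are
    made fixed points on both sides: by four cuts after the merging, and by three cuts for the
    smoothed word. *)
Lemma card_faces_smooth :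
  ((c.1, false), false) \notin porbit (wphi w) ((c.1, false), true) ->
  #|porbits (wphi (flip X Y))| = #|porbits (wphi w)|.
Proof.
move=> hm; have uw := wf_uniq wfw; have uf := flip_uniq.
pose e b o := (((c.1, b), o) : T * bool * bool).
(* The transposition merges the two faces; a face arriving at [c] then visits the dart that the
   smoothing pairs with its own. *)
pose s0 := (wphi w * tperm (e false false) (e false true))%g.
pose th := perm (@theta_inj _ X).
pose s2 := (th * wphi (flip X Y) * th^-1)%g.
have s2E x : theta X (s2 x) = dphi (flip X Y) (theta X x).
  by rewrite -[theta X (s2 x)](permE (@theta_inj _ X)) -/th !permM permKV !permE wphiE.
have s2c : #|porbits s2| = #|porbits (wphi (flip X Y))|.
  by apply: (card_porbits_conj (@theta_inj _ X)) => x; rewrite s2E wphiE.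
have s2out x : x.1 \notin rev X ++ Y -> s2 x = dsig (x.1, ~~ x.2).
  move=> h; apply: (@theta_inj _ X); rewrite s2E theta_sig (theta_out h).
  by rewrite /dphi dalp_flip_out // theta_out.
have s2in x : x.1 \in rev X ++ Y -> s2 x = dsig (skip w c (dalp w x)).
  by move=> h; apply: (@theta_inj _ X); rewrite s2E theta_sig /dphi (dalp_smooth wfw).
have nl b : (c.1, b) \notin rev X ++ Y.
  by apply/negP => /(smooth_label wfw); rewrite eqxx.
have s0E x : s0 x = if (dalp w x).1.1 == c.1 then (bar (dalp w x).1, (dalp w x).2)
                    else dsig (dalp w x).
  rewrite /s0 permM wphiE // /dphi; case: eqP => [|/eqP].
    case: (dalp w x) => [[u b] o] /= ->; rewrite /dsig /bar /=.
    case: b; case: o => /=; rewrite ?tpermL ?tpermR // tpermD //;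
      by rewrite /e !xpair_eqE ?andbF.
  case: (dalp w x) => [[u b] o] /= nu; rewrite tpermD // /e /dsig /bar /= !xpair_eqE.
    by rewrite eq_sym (negbTE nu).
  by rewrite eq_sym (negbTE nu).
pose C := [:: e true true; e true false; e false true; e false false].
have inC x : (x \in C) = (x.1.1 == c.1).
  case: x => [[u b] o]; rewrite !inE !xpair_eqE /=.
  by case: eqP => //= _; case: b; case: o.
have uC : uniq C by rewrite /= !inE !xpair_eqE !eqxx.
have C0 z : z \in C -> s0 z \notin C.
  rewrite !inC => /eqP hz; rewrite s0E.
  by rewrite (negbTE (smooth_label wfw (dalp_center hz))) /= (smooth_label wfw) // dalp_center.
have [k0 card0] := cutsE uC C0.
have card1 : #|porbits s0|.+1 = #|porbits (wphi w)| := card_porbit_merge hm.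
have s2e b o : s2 (e b o) = dsig (e b (~~ o)) by rewrite s2out ?nl.
pose r1 := cut s2 (e false true).
pose r2 := cut r1 (e false false).
pose r3 := cut r2 (e true false).
have r1E x : r1 x = _ := cutE _ _ _.
have r2E x : r2 x = _ := cutE _ _ _.
have r3E x : r3 x = _ := cutE _ _ _.
have ee b o b' o' : (e b o == e b' o') = (b == b') && (o == o').
  by rewrite /e !xpair_eqE eqxx.
have de b o : dsig (e b o) = e (~~ b) (b (+) o) by [].
have c1 : #|porbits r1| = #|porbits s2|.+1.
  by apply: card_cut; rewrite s2e de ee.
have c2 : #|porbits r2| = #|porbits r1|.+1.
  by apply: card_cut; rewrite r1E !s2e !de !ee.
have c3 : #|porbits r3| = #|porbits r2|.+1.
  by apply: card_cut; rewrite !(r2E, r1E, s2e, de, ee).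
suff E : r3 = cuts s0 C.
  rewrite -s2c; move: card0; rewrite -E c3 c2 c1 -card1 [size C]/= addn4.
  by case.
apply/permP => x; rewrite k0; case: ifP => xC.
  move: (xC); rewrite !inE => /or4P[] /eqP ->.
  - by rewrite !(r3E, r2E, r1E, s2e, de, ee).
  - by rewrite r3E eqxx.
  - by rewrite !(r3E, r2E, r1E, s2e, de, ee).
  - by rewrite !(r3E, r2E, r1E, s2e, de, ee).
have nC b o : (x == e b o) = false by apply/eqP => h; rewrite h inC eqxx in xC.
have [r Er rC] : exists2 r, s2 x = r & r.1.1 != c.1.
  exists (s2 x) => //; rewrite -inC; apply/negP => h.
  have [z zC ez] : exists2 z, z \in C & s2 z = s2 x.
    move: h; rewrite !inE => /or4P[] /eqP ->.
    - by exists (e false false); rewrite ?s2e ?de ?inC.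
    - by exists (e false true); rewrite ?s2e ?de ?inC.
    - by exists (e true true); rewrite ?s2e ?de ?inC.
    - by exists (e true false); rewrite ?s2e ?de ?inC.
  by move/perm_inj: ez => ez; rewrite -ez zC in xC.
have rn b o : (r == e b o) = false.
  by apply/eqP => h; rewrite h eqxx in rC.
have -> : r3 x = r.
  by rewrite !(r3E, r2E, r1E) Er !nC /= !rn.
rewrite -Er; rewrite inC in xC.
case: (boolP (x.1 \in rev X ++ Y)) => hx.
  rewrite s2in // /skip; case: eqP => ha.
    have hb : (dalp w (bar (dalp w x).1, (dalp w x).2)).1 \in rev X ++ Y.
      exact: dalp_center.
    have -> : s0 x = (bar (dalp w x).1, (dalp w x).2) by rewrite s0E ha eqxx.
    by rewrite inC /= ha eqxx s0E (negbTE (smooth_label wfw hb)).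
  by rewrite s0E; move/eqP/negbTE: ha => ha; rewrite ha inC /= ha.
have xw : x.1 \notin w by rewrite in_smooth xC.
have -> : s0 x = dsig (x.1, ~~ x.2).
  rewrite s0E (_ : dalp w x = (x.1, ~~ x.2)) /= ?xC //.
  by case: (x) xw => l []; rewrite /= ?dalp_out ?dalp_in => h; rewrite ?next_notin ?prev_notin.
by rewrite inC /= xC s2out.
Qed.

End Smooth.
End Count.

(** * Interlacement *)

Section Interlacement.
Variable T : finType.
Implicit Types (l m c : T * bool) (w X Y : seq (T * bool)) (d : T * bool * bool) (u v p q : T).

Fixpoint ordc u v (s : seq T) :=
  if s is x :: s' then (x == u) * count_mem v s' + ordc u v s' else 0.

(* For [u != v], both occurring twice, the number of pairs of positions [i < j]
   carrying [u] and [v] is odd exactly in the patterns [uvuv] and [vuvu]. *)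
Definition il w u v := (u != v) && odd (ordc u v (map fst w)).

Definition labels w := [set u | (u, true) \in w].

Lemma ordc_cat u v (s t : seq T) :
  ordc u v (s ++ t) = ordc u v s + ordc u v t + count_mem u s * count_mem v t.
Proof.
elim: s => [|x s IH] /=; first by rewrite mul0n addn0.
rewrite IH count_cat; ring.
Qed.

Lemma ordc_rev u v (s : seq T) : u != v ->
  ordc u v (rev s) + ordc u v s = count_mem u s * count_mem v s.
Proof.
move=> uv; elim: s => //= x s IH.
rewrite rev_cons -cats1 ordc_cat /= count_rev.
by case: eqP => [->|_]; case: eqP => [e|_]; rewrite ?e ?eqxx // in uv *; lia.
Qed.

Lemma ordc_sym u v (s : seq T) : u != v ->
  ordc u v s + ordc v u s = count_mem u s * count_mem v s.
Proof.
move=> uv; elim: s => //= x s IH.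
by case: eqP => [->|_]; case: eqP => [e|_]; rewrite ?e ?eqxx // in uv *; lia.
Qed.

Lemma count_label X u : uniq X ->
  count_mem u (map fst X) = ((u, true) \in X) + ((u, false) \in X).
Proof.
move=> uX; rewrite -!count_uniq_mem // count_map.
elim: X {uX} => //= -[v b] X ->; rewrite !xpair_eqE /=.
by case: eqP => _; case: b => /=; lia.
Qed.

Lemma oddX_count X u : uniq X -> oddX X u = odd (count_mem u (map fst X)).
Proof. by move=> uX; rewrite count_label // oddD !oddb. Qed.

Lemma wf_count w u : wf w -> count_mem u (map fst w) = (u \in labels w).*2.
Proof.
move=> wfw; rewrite count_label ?wf_uniq // inE -(wf_bar (u, false)) // /bar /=.
by rewrite addnn.
Qed.

Lemma mem_wf w l : wf w -> (l \in w) = (l.1 \in labels w).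
Proof. by move=> wfw; rewrite inE; case: l => u [] //=; rewrite -(wf_bar (u, true)). Qed.

Lemma il_sym w p q : wf w -> il w p q = il w q p.
Proof.
move=> wfw; rewrite /il eq_sym; case: eqP => //= /eqP pq; rewrite eq_sym in pq.
have := congr1 odd (ordc_sym (map fst w) pq); rewrite oddD oddM !wf_count //.
by rewrite !odd_double; case: odd; case: odd.
Qed.

Lemma il_irr w p : il w p p = false.
Proof. by rewrite /il eqxx. Qed.

Lemma il_unused w p q : wf w -> il w p q -> p \in labels w.
Proof.
move=> wfw /andP[pq]; apply: contraLR => pw.
have h := ordc_sym (map fst w) pq.
have e := wf_count p wfw; rewrite (negbTE pw) /= in e.
have : ordc p q (map fst w) = 0 by move: h; rewrite e; lia.
by move=> ->.
Qed.

(** Moving a prefix to the end exchanges the cross terms of [ordc_cat]. Their parities agree because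
    every label occurs an even number of times. *)
Lemma il_rot i w p q : wf w -> il (rot i w) p q = il w p q.
Proof.
move=> wfw; rewrite /il /rot map_cat; congr (_ && _).
have c u : odd (count_mem u (map fst (take i w))) = odd (count_mem u (map fst (drop i w))).
  have := congr1 odd (wf_count u wfw).
  by rewrite -{1}(cat_take_drop i w) map_cat count_cat oddD odd_double; case: odd; case: odd.
rewrite -{3}(cat_take_drop i w) map_cat !ordc_cat !oddD !oddM !c.
by rewrite [_ (+) odd (ordc p q (map fst (take i w)))]addbC andbC [in RHS]andbC andbC.
Qed.

Section Smooth.
Variables (c : T * bool) (X Y : seq (T * bool)).
Let w := c :: X ++ bar c :: Y.
Hypothesis (wfw : wf w).

Let uX : uniq X.
Proof. by have := wf_uniq wfw; rewrite /w /= cat_uniq => /and3P[_ ->]. Qed.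

Lemma oddX_center : oddX X c.1 = false.
Proof.
have [h1 _ h3 _] := notin_smooth wfw.
by rewrite /oddX; case: (c) h1 h3 => u [] /= /negbTE h1 /negbTE; rewrite /bar /= h1 => ->.
Qed.

Lemma oddX_centerY : count_mem c.1 (map fst X) = 0 /\ count_mem c.1 (map fst Y) = 0.
Proof.
have uY : uniq Y by have := wf_uniq wfw; rewrite /w /= cat_uniq /= => /and5P[].
have [h1 h2 h3 h4] := notin_smooth wfw; rewrite !count_label //.
by case: (c) h1 h2 h3 h4 => u []; rewrite /bar /= => /negbTE -> /negbTE -> /negbTE -> /negbTE ->.
Qed.

Lemma il_center p : il w c.1 p = oddX X p.
Proof.
rewrite /il; case: eqP => [<-|/eqP cp] /=; first by rewrite oddX_center.
have [e1 e2] := oddX_centerY.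
have z s : count_mem c.1 s = 0 -> ordc c.1 p s = 0.
  by move=> h; have := ordc_sym s cp; rewrite h; lia.
rewrite oddX_count // map_cat ordc_cat /= eqxx /= !count_cat /= (negbTE cp) !z // e1.
by rewrite !(mul1n, mul0n, addn0, add0n) -addnA addnn oddD odd_double addbF.
Qed.

(** Reversal changes the order only of pairs inside [X]. Their number is the product of the two
    counts in [X], whose parities are the adjacencies to [c]. *)
Lemma il_flip p q : p != q -> p != c.1 -> q != c.1 ->
  il (flip X Y) p q = il w p q (+) (il w c.1 p && il w c.1 q).
Proof.
move=> pq pc qc; rewrite !il_center /il pq /=.
have -> : map fst (flip X Y) = rev (map fst X) ++ map fst Y.
  by rewrite /flip -map_comp (eq_map (g := fst)) // map_cat map_rev.
rewrite eq_sym (negbTE pc) mul0n add0n map_cat /= !ordc_cat /= eq_sym (negbTE pc) /=.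
rewrite eq_sym in qc; rewrite (negbTE qc) !add0n count_rev !oddD !oddM.
have := congr1 odd (ordc_rev (map fst X) pq); rewrite oddD oddM !(oddX_count _ uX) => <-.
by do 5!case: odd.
Qed.

Lemma wf_flip : wf (flip X Y).
Proof.
apply/andP; split; first exact: (flip_uniq wfw).
apply/allP => _ /mapP[l lv ->].
have -> : bar (tog X l) = tog X (bar l) by rewrite /bar /tog /= addNb.
rewrite mem_flip; have nc := smooth_label wfw lv.
have : bar l \in w by rewrite wf_bar // in_smooth // lv orbT.
by rewrite in_smooth //= (negbTE nc).
Qed.

Lemma labels_flip : labels (flip X Y) = labels w :\ c.1.
Proof.
apply/setP => u; rewrite in_setD1.
have e : (u, true) = tog X (u, ~~ oddX X u) by rewrite /tog /= addNb addbb.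
rewrite inE e mem_flip -(mem_wf (u, ~~ oddX X u) wfw) in_smooth // [_.1]/=.
by case: eqP => //= h; apply/negP => /(smooth_label wfw); rewrite h eqxx.
Qed.

End Smooth.

Section Insert.
Variables (c : T * bool) (X Y : seq (T * bool)).
Hypothesis (wfw : wf (X ++ Y)) (cw : c.1 \notin labels (X ++ Y)).
Let X' := map (tog X) (rev X).
Let Y' := map (tog X) Y.
(** A splice as the inverse of smoothing: [X] is reversed and the crossings that it meets once
    change sign, so that [flip] gives back [X ++ Y]. *)
Definition insert := c :: map (tog X) (rev X) ++ bar c :: map (tog X) Y.

Lemma togK : involutive (tog X).
Proof. by case=> u b; rewrite /tog /= -addbA addbb addbF. Qed.

Lemma mem_tog l (A : seq (T * bool)) : (l \in map (tog X) A) = (tog X l \in A).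
Proof. by rewrite -{1}(togK l) mem_map //; exact: tog_inj. Qed.

Lemma oddX_insert u : oddX X' u = oddX X u.
Proof.
rewrite {1}/oddX /X' !mem_tog !mem_rev /tog /=.
have := erefl (oddX X u); rewrite {1}/oddX.
by case: (oddX X u) => /= h; rewrite ?h // addbC h.
Qed.

Lemma tog_insert : tog X' =1 tog X.
Proof. by move=> l; rewrite /tog oddX_insert. Qed.

Lemma flip_insert : flip X' Y' = X ++ Y.
Proof.
rewrite /flip (eq_map tog_insert) /X' -map_rev revK map_cat -!map_comp.
by rewrite !(eq_map (f := tog X \o tog X) (g := id)) ?map_id // => l; apply: togK.
Qed.

Lemma wf_insert : wf insert.
Proof.
have uXY := wf_uniq wfw.
have nc l (A : seq (T * bool)) : {subset A <= X ++ Y} -> l.1 = c.1 -> l \notin map (tog X) A.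
  move=> sA e; rewrite mem_tog; apply/negP => /sA.
  by rewrite mem_wf //= e (negbTE cw).
have sX : {subset rev X <= X ++ Y} by move=> l; rewrite mem_rev mem_cat => ->.
have sY : {subset Y <= X ++ Y} by move=> l; rewrite mem_cat orbC => ->.
apply/andP; split.
  rewrite /= mem_cat inE !negb_or (nc c) //= (nc c _ sY) // eq_sym bar_neq /=.
  rewrite cat_uniq /= (nc (bar c) _ sY) // (negbTE (nc (bar c) _ sX _)) //.
  rewrite !map_inj_uniq; [|exact: tog_inj..].
  move: uXY; rewrite cat_uniq rev_uniq => /and3P[-> h ->] /=; rewrite andbT.
  apply/hasPn => _ /mapP[l lY ->]; rewrite /= mem_map; last exact: tog_inj.
  by rewrite mem_rev; move/hasPn: h => /(_ l lY).
have in_i l : (l \in insert) = (l.1 == c.1) || (tog X l \in X ++ Y).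
  rewrite /insert inE mem_cat inE !mem_tog mem_rev mem_cat.
  case: (eqVneq l.1 c.1) => [e|ne] /=.
    by have [->|->] := same_label (esym e); rewrite eqxx ?orbT.
  case: eqP => [h|_ /=]; first by rewrite h eqxx in ne.
  by case: eqP => [h|_ //]; rewrite h /= eqxx in ne.
apply/allP => l; rewrite !in_i => /orP[->//|h].
by rewrite mem_wf //= mem_wf //= in h *; rewrite h orbT.
Qed.

Lemma labels_insert : labels insert = c.1 |: labels (X ++ Y).
Proof.
have := labels_flip wf_insert; rewrite -/X' -/Y' flip_insert => ->.
by rewrite setD1K // -mem_wf ?mem_head ?wf_insert.
Qed.

Lemma il_insert_new p : il insert c.1 p = oddX X p.
Proof. by rewrite (il_center wf_insert) oddX_insert. Qed.

Lemma il_insert p q : p != q -> p != c.1 -> q != c.1 ->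
  il insert p q = il (X ++ Y) p q (+) (oddX X p && oddX X q).
Proof.
move=> pq pc qc; have := il_flip wf_insert pq pc qc.
rewrite -/X' -/Y' flip_insert !il_insert_new => ->.
by rewrite -addbA addbb addbF.
Qed.

End Insert.
End Interlacement.

(** * Words and projections *)

Section Models.
Variable T : finType.
Implicit Types (l m c : T * bool) (w X Y : seq (T * bool)) (d : T * bool * bool) (u v : T).

Definition models (p : kproj) w := exists f : kd p -> T * bool * bool,
  [/\ injective f, (forall d, d.1 \in w <-> exists x, f x = d),
      (forall x, f (ksig p x) = dsig (f x)) & (forall x, f (kalp p x) = dalp w (f x))].

(* A label that does not occur in [w] contributes a single face made of its four
   darts, so this is the Euler formula for the crossings that do occur. *)
Definition planar w := #|porbits (wphi w)| = #|T| + 2.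

Definition corners_distinct w := forall x y : T * bool * bool, x.1 \in w -> x.1.1 = y.1.1 -> x != y ->
  y \notin porbit (wphi w) x.

Definition no_isolated w := forall u, u \in labels w -> exists v, il w u v.

Definition good w := [/\ wf w, w != [::], planar w & no_isolated w].

Lemma models_rot p i w : wf w -> models p w -> models p (rot i w).
Proof.
move=> wfw [f [fi fim fs fa]]; exists f; split=> // [d|x]; first by rewrite mem_rot.
by rewrite dalp_rot // wf_uniq.
Qed.

Lemma labels_rot i w : labels (rot i w) = labels w.
Proof. by apply/setP => u; rewrite !inE mem_rot. Qed.

Lemma good_rot i w : good (rot i w) <-> good w.
Proof.
have H j (v : seq (T * bool)) : good v -> good (rot j v).
  move=> [wfv v0 pv iv]; split.
  - by rewrite wf_rot.
  - by rewrite -size_eq0 size_rot size_eq0.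
  - by rewrite /planar wphi_rot ?wf_uniq.
  - by move=> u; rewrite labels_rot => /iv[v' h]; exists v'; rewrite il_rot.
split; last exact: H.
by rewrite -{2}(rotK i w); exact: H.
Qed.

Lemma mem_dalp w d : uniq w -> ((dalp w d).1 \in w) = (d.1 \in w).
Proof. by move=> uw; case: d => l []; rewrite /dalp /= ?mem_next ?mem_prev. Qed.

Lemma mem_dphi w d : wf w -> ((dphi w d).1 \in w) = (d.1 \in w).
Proof. by move=> wfw; rewrite /dphi /= wf_bar // mem_dalp // wf_uniq. Qed.

Lemma dalp_unused w d : d.1 \notin w -> dalp w d = (d.1, ~~ d.2).
Proof. by case: d => l [] /= h; rewrite /dalp /= ?next_notin ?prev_notin. Qed.

Lemma card_faces_model w (D : finType) (s : {perm D}) (f : D -> T * bool * bool) :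
  wf w -> injective f -> (forall d, d.1 \in w <-> exists x, f x = d) ->
  (forall x, f (s x) = dphi w (f x)) ->
  #|porbits s| + #|~: labels w| = #|porbits (wphi w)|.
Proof.
move=> wfw fi fim fs; have uw := wf_uniq wfw.
have fs' x : f (s x) = wphi w (f x) by rewrite wphiE.
rewrite (card_porbits_imset fi fs').
pose e u : T * bool * bool := ((u, true), true).
pose B := [set porbit (wphi w) (e u) | u in ~: labels w].
have unu u b : u \in ~: labels w -> (u, b) \notin w by rewrite mem_wf //= inE.
have lab u d : u \in ~: labels w -> d \in porbit (wphi w) (e u) -> d.1.1 = u.
  move=> hu hd; apply/eqP; move: d hd.
  apply: (porbit_closed (P := fun d => d.1.1 == u)) => [d|]; last by rewrite /= eqxx.
  move=> /eqP hd; rewrite wphiE // /dphi dalp_unused /= ?hd //.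
  by move: (unu u d.1.2 hu); rewrite -{1}hd; case: (d.1).
have cB : #|B| = #|~: labels w|.
  rewrite card_in_imset // => u v hu hv h.
  have := porbit_id (wphi w) (e u); rewrite h => /(lab _ _ hv).
  by [].
have used x d : d \in porbit (wphi w) (f x) -> d.1 \in w.
  apply: (porbit_closed (P := fun d => d.1 \in w)) => [d'|].
    by rewrite wphiE // mem_dphi.
  by apply/fim; exists x.
have <- : [set porbit (wphi w) (f x) | x : D] :|: B = porbits (wphi w).
  apply/setP => O; apply/setUP/imsetP.
    by case=> /imsetP[x _ ->]; [exists (f x)|exists (e x)].
  move=> [d _ ->]; case: (boolP (d.1 \in w)) => dw.
    by left; have /fim[x <-] := dw; apply/imsetP; exists x.
  right; apply/imsetP; exists d.1.1; first by rewrite in_setC -mem_wf.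
  case: d dw => [[u b] o] /=; rewrite mem_wf //= => hu; apply/eqP.
  have hu' : u \in ~: labels w by rewrite in_setC.
  have st b' o' : wphi w ((u, b'), o') = dsig ((u, b'), ~~ o').
    by rewrite wphiE // /dphi dalp_unused //= unu.
  have E b' o' : porbit (wphi w) ((u, b'), o') = porbit (wphi w) (dsig ((u, b'), ~~ o')).
    by rewrite -st porbit_step.
  case: b; case: o => //; rewrite /e.
  - by rewrite E /dsig /bar /= E /dsig /bar /= E.
  - by rewrite E /dsig /bar /= E /dsig /bar /= E.
  - by rewrite E.
rewrite cardsU cB (_ : _ :&: B = set0) ?cards0 ?subn0 //.
apply/setP => O; rewrite !inE; apply/negP => /andP[/imsetP[x _ ->] /imsetP[u hu h]].
have := porbit_id (wphi w) (e u); rewrite -h => /used /=.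
by rewrite (negbTE (unu _ _ hu)).
Qed.

Lemma card_used w : wf w -> #|[pred d : T * bool * bool | d.1 \in w]| = #|labels w| * 4.
Proof.
move=> wfw; have E : [pred d : T * bool * bool | d.1 \in w] =i
    [predX [predX mem (labels w) & predT : pred bool] & predT : pred bool].
  by move=> [[u b] o]; rewrite inE /= mem_wf //= !inE /= !andbT.
by rewrite (eq_card E) !cardX card_bool -mulnA.
Qed.

Lemma models_card p w : wf w -> models p w -> #|kd p| = #|labels w| * 4.
Proof.
move=> wfw [f [fi fim _ _]]; rewrite -(card_used wfw) -(card_codom fi).
apply: eq_card => d; rewrite !inE; apply/codomP/idP.
  by move=> [x ->]; apply/fim; exists x.
by case/fim => x <-; exists x.
Qed.

Lemma models_phi p w f : (forall x, f (ksig p x) = dsig (f x)) ->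
  (forall x, f (kalp p x) = dalp w (f x)) -> forall x, f (kphi p x) = dphi w (f x).
Proof. by move=> fs fa x; rewrite /kphi permM fs fa. Qed.

Lemma models_planar p w : wf w -> models p w -> planar w.
Proof.
move=> wfw mp; have c := models_card wfw mp; case: mp => f [fi fim fs fa].
have := card_faces_model wfw fi fim (models_phi fs fa).
have [c4 c2] := kproj_cards p; have := kproj_sphere p; rewrite -/(kphi p) => h.
have := cardsC (labels w); rewrite /planar; lia.
Qed.

Lemma models_reduced p w : wf w -> models p w -> kreduced p <-> corners_distinct w.
Proof.
move=> wfw [f [fi fim fs fa]]; have fp := models_phi fs fa.
have fp' x : f (kphi p x) = wphi w (f x) by rewrite wphiE ?wf_uniq.
have lab x y : (y \in porbit (ksig p) x) = ((f x).1.1 == (f y).1.1).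
  have [s4 _] := kproj_deg4 x; rewrite mem_porbit4 //.
  rewrite !inE -!(inj_eq fi) !fs; case: (f x) (f y) => [[u b] o] [[v b'] o'].
  rewrite /dsig /bar /= !xpair_eqE eq_sym; case: eqP => //= _.
  by case: b; case: o; case: b'; case: o'.
have orb x y : (porbit (kphi p) x == porbit (kphi p) y) = (f y \in porbit (wphi w) (f x)).
  by rewrite eq_sym eq_porbit_mem (porbit_imset x fp') mem_imset.
split=> [red x y xw e nxy|cd x y nxy hy].
  have /fim[x' ex] := xw; have /fim[y' ey] : y.1 \in w.
    by move: xw; rewrite !mem_wf // e.
  by rewrite -ex -ey -orb red ?lab ?ex ?ey ?e // -(inj_eq fi) ex ey.
rewrite orb cd ?(inj_eq fi) //; first by apply/fim; exists x.
by apply/eqP; rewrite -lab.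
Qed.

Lemma planar_model w : wf w -> w != [::] -> planar w -> exists p, models p w.
Proof.
move=> wfw w0 pw; have uw := wf_uniq wfw.
pose D : finType := {d : T * bool * bool | d.1 \in w}.
have vi : injective (val : D -> _) := val_inj.
have im d : d.1 \in w <-> exists x : D, val x = d.
  split; first by move=> h; exists (exist _ d h).
  by move=> [x <-]; exact: valP x.
have build (f : T * bool * bool -> T * bool * bool) : injective f ->
    (forall d, d.1 \in w -> (f d).1 \in w) -> exists s : {perm D}, forall x, val (s x) = f (val x).
  move=> fi fw; pose g (x : D) : D := exist _ (f (val x)) (fw _ (valP x)).
  have gi : injective g by move=> x y /(congr1 val) /= /fi /vi.
  by exists (perm gi) => x; rewrite permE.
have [|s sE] := build (@dsig T) (@dsig_inj T); first by move=> d h; rewrite /= wf_bar.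
have [|a aE] := build (dalp w) (inv_inj (dalpK uw)); first by move=> d; rewrite mem_dalp.
have [l0 lw] : exists l, l \in w by case: (w) w0 => // l w' _; exists l; exact: mem_head.
have h4 (x : D) : s (s (s (s x))) = x /\ s x != x /\ s (s x) != x.
  split; first by apply: vi; rewrite !sE dsig4.
  rewrite -!(inj_eq vi) !sE; case: (val x) => [[u b] o].
  by rewrite /dsig /bar /= !xpair_eqE; case: b; case: o; rewrite ?andbF.
have h2 (x : D) : a (a x) = x /\ a x != x.
  split; first by apply: vi; rewrite !aE dalpK.
  by rewrite -!(inj_eq vi) aE; case: (val x) => l []; rewrite /dalp /= xpair_eqE andbF.
(* Straight-ahead motion keeps the flag, going forwards on incoming darts and backwards on outgoing
   ones. This yields the two orbits of a single curve. *)
have tE x : val ((s * s * a)%g x) =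
    if (val x).2 then (prev w (val x).1, true) else (next w (val x).1, false).
  by rewrite !permM aE !sE; case: (val x) => [[u []] []].
have t0 (x : D) k : (val x).2 = false ->
    val (((s * s * a) ^+ k)%g x) = (iter k (next w) (val x).1, false).
  move=> hx; elim: k => [|k IH]; first by rewrite perm1 -hx; case: (val x).
  by rewrite expgSr permM tE IH.
have t1 (x : D) k : (val x).2 = true ->
    val (((s * s * a) ^+ k)%g x) = (iter k (prev w) (val x).1, true).
  move=> hx; elim: k => [|k IH]; first by rewrite perm1 -hx; case: (val x).
  by rewrite expgSr permM tE IH.
have same x y : (val x).2 = (val y).2 -> y \in porbit (s * s * a)%g x.
  move=> e; apply/porbitP; case hx: (val x).2; rewrite hx in e.
    have [k hk] := fconnect_next uw (valP y) (valP x); exists k; apply: vi.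
    rewrite t1 // -hk (_ : iter k (prev w) _ = (val y).1) ?e; first by case: (val y).
    by elim: k {hk} => //= k IH; rewrite -iterS iterSr /= prev_next.
  have [k hk] := fconnect_next uw (valP x) (valP y); exists k; apply: vi.
  by rewrite t0 // hk e; case: (val y).
have c4 : #|D| = #|labels w| * 4 by rewrite card_sig -card_used.
have c1 : #|porbits (a * s)%g| + #|~: labels w| = #|porbits (wphi w)|.
  by apply: card_faces_model vi im _ => // x; rewrite permM sE aE.
have sph : #|porbits s| + #|porbits (a * s)%g| = #|porbits a| + 2.
  have q4 : #|porbits s| * 4 = #|D|.
    by apply: card_porbits_const => x; have [? [? ?]] := h4 x; apply: card_porbit4.
  have q2 : #|porbits a| * 2 = #|D|.
    by apply: card_porbits_const => x; have [? ?] := h2 x; apply: card_porbit2.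
  have := cardsC (labels w); rewrite pw in c1; lia.
have pos : 0 < #|D|.
  by apply/card_gt0P; exists (exist _ (l0, false) lw).
have sing : #|porbits (s * s * a)%g| = 2.
  pose x0 : D := exist _ (l0, false) lw; pose x1 : D := exist _ (l0, true) lw.
  have -> : porbits (s * s * a)%g = [set porbit (s * s * a)%g x0; porbit (s * s * a)%g x1].
    apply/setP => O; rewrite !inE; apply/imsetP/orP.
      move=> [x _ ->]; rewrite !eq_porbit_mem; case hx: (val x).2.
        by right; apply: same.
      by left; apply: same.
    by case=> /eqP ->; [exists x0|exists x1].
  rewrite cards2 eq_porbit_mem (_ : _ \in _ = false) //.
  by apply/negP => /porbitP[k] /(congr1 val); rewrite t1.
have con (x y : D) : connect (fun z z' => (z' == s z) || (z' == a z)) x y.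
  have cs z : connect (fun z z' => (z' == s z) || (z' == a z)) z (s z).
    by apply: connect1; rewrite eqxx.
  have ca z : connect (fun z z' => (z' == s z) || (z' == a z)) z (a z).
    by apply: connect1; rewrite eqxx orbT.
  have ct z k : connect (fun z z' => (z' == s z) || (z' == a z)) z (((s * s * a) ^+ k)%g z).
    elim: k => [|k IH]; first by rewrite perm1.
    rewrite expgSr permM; apply: connect_trans IH _; rewrite !permM.
    exact: connect_trans (cs _) (connect_trans (cs _) (ca _)).
  have fl z : val (s (s z)) = ((val z).1, ~~ (val z).2).
    by rewrite !sE; case: (val z) => [[u []] []].
  case: (eqVneq (val x).2 (val y).2) => e.
    by have /porbitP[k ->] := same x y e.
  apply: connect_trans (cs _) _; apply: connect_trans (cs _) _.
  have e' : (val (s (s x))).2 = (val y).2.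
    by rewrite fl /=; case: (val x).2 (val y).2 e => [] [].
  by have /porbitP[k ->] := same (s (s x)) y e'.
exists (KProj pos h4 h2 con sph sing); exists val; split=> //.
Qed.

End Models.

(** * The Gauss word of a projection *)

Section GaussWord.
Variable p : kproj.
Local Notation s := (ksig p).
Local Notation a := (kalp p).
Local Notation t := (s * s * a)%g.

Let s4 x : s (s (s (s x))) = x. Proof. by have [] := kproj_deg4 x. Qed.
Let a2 x : a (a x) = x. Proof. by have [] := kproj_edge x. Qed.

(* [s^2] reverses the direction of travel *)
Lemma straight_reverse x : s (s x) = t (s (s (t x))).
Proof. by rewrite !permM s4 a2. Qed.

(* If [s^2 x] were on the oriented curve through [x], the point half-way would
   be fixed by [s^2], or its edge would be fixed by [a]. *)
Lemma straight_disjoint x : s (s x) \notin porbit t x.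
Proof.
apply/negP => /porbitP[k]; rewrite permX => e.
have H i : i <= k -> s (s (iter i t x)) = iter (k - i) t x.
  elim: i => [|i IH] hi; first by rewrite subn0.
  apply: (@perm_inj _ t); rewrite /= -straight_reverse IH; last exact: ltnW.
  by rewrite -iterS -subSn.
have hk : k./2 <= k by lia.
have := H _ hk; set y := iter k./2 t x.
have -> : iter (k - k./2) t x = iter (odd k) t y.
  by rewrite /y -iterD; congr (iter _ _ _); have := odd_double_half k; lia.
have [_ [_ n2]] := kproj_deg4 y; case: odd => /= h; last by rewrite h eqxx in n2.
have [_] := kproj_edge (s (s y)); rewrite {2}h !permM eqxx.
by [].
Qed.

Variable x0 : kd p.
Definition onO x := x \in porbit t x0.

Lemma onO_straight x : onO (t x) = onO x.
Proof. by rewrite /onO -!eq_porbit_mem porbit_step. Qed.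

(** [kproj_single] allows two orbits only; by [straight_disjoint] they are that of [x0] and its
    reversal. *)
Lemma onO_sig2 x : onO (s (s x)) = ~~ onO x.
Proof.
have inv y z : z \in porbit t y -> porbit t (s (s z)) = porbit t (s (s y)).
  move=> h; apply: (porbit_invariant (f := fun z => porbit t (s (s z))) _ h) => {h}z _.
  by rewrite (straight_reverse z) porbit_step.
have two : forall z, z \in porbit t x0 \/ z \in porbit t (s (s x0)).
  have e : [set porbit t x0; porbit t (s (s x0))] = porbits t.
    apply/eqP; rewrite eqEcard kproj_single cards2 eq_sym eq_porbit_mem straight_disjoint andbT.
    by apply/subsetP => O; rewrite !inE => /orP[] /eqP ->; apply: imset_f.
  move=> z; have : porbit t z \in porbits t by exact: imset_f.
  by rewrite -e !inE !eq_porbit_mem => /orP.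
rewrite /onO; case: (two x) => h; rewrite -[in LHS]eq_porbit_mem.
  by rewrite h (inv _ _ h) eq_porbit_mem (negbTE (straight_disjoint x0)).
rewrite (inv _ _ h) s4 eqxx; apply/esym/negP => h'.
have := straight_disjoint x0; rewrite -eq_porbit_mem.
move: h h'; rewrite -!eq_porbit_mem => /eqP <- /eqP ->.
by rewrite eqxx.
Qed.

Lemma onO_alp x : onO (a x) = ~~ onO x.
Proof. by rewrite -onO_sig2 -(onO_straight (s (s x))) !permM s4. Qed.

(** A crossing is named by its incoming dart on the strand of sign [false]. Labels are thus darts,
    and three of the four darts at each crossing remain free for later insertions. *)
Definition glab y := if onO (s y) then (y, false) else (s (s (s y)), true).
Definition gdec (l : kd p * bool) := if l.2 then s l.1 else l.1.
Definition gword := map glab (traject t x0 #|porbit t x0|).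
Definition gdart x := (glab (if onO x then x else s (s x)), ~~ onO x).

Lemma glabK : cancel glab gdec.
Proof. by move=> y; rewrite /glab /gdec; case: (onO (s y)) => //=; rewrite s4. Qed.

Lemma mem_gword l : reflect (exists2 y, onO y & l = glab y) (l \in gword).
Proof.
by apply: (iffP mapP) => -[y]; rewrite -?porbit_traject => h e; exists y;
   rewrite ?e // -porbit_traject.
Qed.

Lemma gword_uniq : uniq gword.
Proof. by rewrite /gword (map_inj_uniq (can_inj glabK)) uniq_traject_porbit. Qed.

Lemma next_gword y : onO y -> next gword (glab y) = glab (t y).
Proof.
move=> hy; rewrite /gword (next_map (can_inj glabK)) ?uniq_traject_porbit //; congr glab.
have hc : fcycle t (traject t x0 #|porbit t x0|).
  have := card_porbit_neq0 t x0; have := iter_porbit t x0.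
  case: #|_| => // n e _.
  rewrite trajectS /= rcons_path fpath_traject /= last_traject -iterS e eqxx //.
have hy' : y \in traject t x0 #|porbit t x0| by rewrite -porbit_traject.
by have /eqP <- := next_cycle hc hy'.
Qed.

Lemma gdart_inj : injective gdart.
Proof.
move=> x y e; have e2 := congr1 snd e; have /(can_inj glabK) := congr1 fst e.
move: e2 => /= /negb_inj ->; case: ifP => // _ /perm_inj/perm_inj //.
Qed.

Lemma gdart_sig x : gdart (s x) = dsig (gdart x).
Proof.
rewrite /gdart /dsig /bar /glab /=.
have := onO_sig2 x; have := onO_sig2 (s x); have := onO_sig2 (s (s x)).
case h1: (onO x) => /=; case h2: (onO (s x)) => /= h3 h4 h5;
  by rewrite ?s4 ?h1 ?h2 ?h3 ?h4 ?h5 ?s4 /= ?h1 ?h2 ?h3 ?h4 ?h5 ?s4.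
Qed.

Lemma gdart_alp x : gdart (a x) = dalp gword (gdart x).
Proof.
rewrite /gdart onO_alp; case h: (onO x) => /=.
  have h' : onO (s (s (a x))) by rewrite onO_sig2 onO_alp h.
  rewrite dalp_in; congr (_, _); have := next_gword h'; rewrite !permM s4 a2.
  by move=> <-; rewrite prev_next ?gword_uniq.
by rewrite dalp_out next_gword ?onO_sig2 ?h // !permM s4.
Qed.

Lemma gdart_im d : d.1 \in gword <-> exists x, gdart x = d.
Proof.
split.
  case: d => l o /= /mem_gword[y hy ->]; case: o.
    by exists (s (s y)); rewrite /gdart onO_sig2 hy /= s4.
  by exists y; rewrite /gdart hy.
move=> [x <-]; apply/mem_gword; rewrite /gdart /=.
by case h: (onO x); [exists x|exists (s (s x)); rewrite ?onO_sig2 ?h].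
Qed.

Lemma gword_wf : wf gword.
Proof.
rewrite /wf gword_uniq; apply/allP => l lw.
have /gdart_im[x e] : (l, false).1 \in gword by [].
have : (dsig (l, false)).1 \in gword by rewrite -e -gdart_sig; apply/gdart_im; exists (s x).
by [].
Qed.

Lemma gword_models : models p gword.
Proof.
exists gdart; split; [exact: gdart_inj|exact: gdart_im|exact: gdart_sig|exact: gdart_alp].
Qed.

End GaussWord.

(** * Distinct corners and isolated vertices *)

Section Corners.
Variable T : finType.
Implicit Types (l m c : T * bool) (w X Y : seq (T * bool)) (d : T * bool * bool) (u v : T).

(** [c :: X] lists the letters from which an edge of the loop cut off at [c] departs; the right-hand
    side describes where these edges arrive. *)
Lemma arc_prev c X Y l : let w := c :: X ++ bar c :: Y in wf w -> l \in w ->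
  (prev w l \in c :: X) = (l != c) && ((l == bar c) || (l \in X)).
Proof.
move=> w wfw lw; have uw := wf_uniq wfw; have [h1 h2 h3 h4] := notin_smooth wfw.
have us := smooth_uniq wfw.
have XY m : m \in Y -> m \notin X.
  move=> mY; move: us; rewrite cat_uniq => /and3P[_ /hasPn h _].
  by have := h _ mY; rewrite /= mem_rev.
have prevE m k A B : w = A ++ m :: k :: B -> prev w k = m.
  by move=> e; rewrite e; have [] := @adj_cat _ A m k B; rewrite -?e.
move: (lw); rewrite /w inE mem_cat inE => /or4P[/eqP ->|lX|/eqP ->|lY].
- have [_ ->] := adj_last uw; rewrite eqxx last_cat [last _ (_ :: _)]/=.
  apply/negbTE/negP => h; have : last (bar c) Y \in bar c :: Y by exact: mem_last.
  rewrite inE => /orP[/eqP e|/XY]; move: h; rewrite ?e inE.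
    by rewrite (negbTE (bar_neq c)) (negbTE h3).
  case/orP=> [/eqP e|->//]; have := mem_last (bar c) Y; rewrite e inE eq_sym.
  by rewrite (negbTE (bar_neq c)) (negbTE h2).
- have lc : l != c by apply: contraNneq h1 => <-.
  rewrite lc lX orbT; have [X1 [X2 eX]] := mem_split lX.
  case/lastP: X1 eX => [|X1 m] eX.
    by rewrite (prevE c l [::] (X2 ++ bar c :: Y)) ?mem_head // /w eX.
  rewrite (prevE m l (c :: X1) (X2 ++ bar c :: Y)) //; last by rewrite /w eX cat_rcons -catA.
  by rewrite inE eX mem_cat mem_rcons mem_head orbT.
- rewrite (prevE (last c X) (bar c) (belast c X) Y) ?mem_last ?bar_neq ?eqxx //.
  by rewrite /w -cat_cons lastI cat_rcons.
- have lc : l != c by apply: contraNneq h2 => <-.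
  have lb : l != bar c by apply: contraNneq h4 => <-.
  rewrite lc (negbTE lb) (negbTE (XY _ lY)) orbF andbF.
  have [Y1 [Y2 eY]] := mem_split lY.
  have [m [B [e mB]]] : exists m B, w = B ++ m :: l :: Y2 /\ m \in bar c :: Y.
    case/lastP: Y1 eY => [|Y1 m] eY.
      by exists (bar c), (c :: X); rewrite mem_head /w eY.
    exists m, (c :: X ++ bar c :: Y1); split; first by rewrite /w eY cat_rcons /= -catA.
    by rewrite eY inE mem_cat mem_rcons mem_head orbT.
  rewrite (prevE _ _ _ _ e); apply/negP; move: mB; rewrite !inE => /orP[/eqP ->|mY].
    by rewrite (negbTE (bar_neq c)) (negbTE h3).
  by rewrite (negbTE (XY _ mY)) orbF => /eqP em; rewrite -em mY in h2.
Qed.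

(** The unit flow along the edges departing from letters in [E], as an antisymmetric function on
    darts. *)
Definition jump w (E : pred (T * bool)) d : rat :=
  if d.2 then (E d.1)%:R%R else (- (E (prev w d.1))%:R)%R.

Lemma jump_alp w E d : uniq w -> (jump w E (dalp w d) = - jump w E d)%R.
Proof. by move=> uw; case: d => l []; rewrite /jump /= ?opprK // prev_next. Qed.

(** The loop is closed, so its flow is conserved at every crossing and has a potential on the faces:
    up to sign and a constant, the winding number of the loop. *)
Lemma loop_potential p c X Y : let w := c :: X ++ bar c :: Y in wf w -> models p w ->
  exists h : T * bool * bool -> rat,
    (forall d, d.1 \in w -> h (dphi w d) = h d) /\
    (forall d, d.1 \in w -> h d - h (dsig d) = jump w (mem (c :: X)) d)%R.
Proof.
move=> w wfw [f [fi fim fs fa]]; have uw := wf_uniq wfw.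
pose g x := jump w (mem (c :: X)) (f x).
have fw x : (f x).1 \in w by apply/fim; exists x.
have sumE u : u \in labels w ->
   (jump w (mem (c :: X)) ((u, true), true) + jump w (mem (c :: X)) ((u, false), true)
    + jump w (mem (c :: X)) ((u, true), false) + jump w (mem (c :: X)) ((u, false), false) = 0)%R.
  move=> uu; have in1 : (u, true) \in w by rewrite mem_wf.
  have in2 : (u, false) \in w by rewrite mem_wf.
  have [h1 _ h3 _] := notin_smooth wfw.
  rewrite /jump /= !arc_prev //; rewrite /w !inE.
  case ec : ((u, true) == c).
    have e2 : ((u, false) == c) = false by rewrite -(eqP ec) xpair_eqE andbF.
    have e3 : ((u, false) == bar c) by rewrite -(eqP ec).
    have e4 : ((u, false) \in X) = false by rewrite (eqP e3) (negbTE h3).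
    by rewrite e2 e3 e4 /=.
  case eb : ((u, true) == bar c).
    have e2 : ((u, false) == c) by rewrite -(inj_eq (inv_inj (@barK T))) -(eqP eb).
    have e4 : ((u, true) \in X) = false by rewrite (eqP eb) (negbTE h3).
    by rewrite e2 e4 /=.
  have e2 : ((u, false) == c) = false by rewrite -(inj_eq (inv_inj (@barK T))).
  have e3 : ((u, false) == bar c) = false by rewrite -(inj_eq (inv_inj (@barK T))) barK.
  rewrite e2 e3 /=; lra.
have [|x|h [hphi hg]] := @kproj_potential p g.
- by move=> x; rewrite /g fa jump_alp.
- have uu : (f x).1.1 \in labels w by rewrite -mem_wf.
  rewrite /g !fs; case: (f x) uu => [[u b] o] /= uu; have := sumE _ uu.
  by rewrite /dsig /bar /=; case: b; case: o => /= <-; ring.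
(* The value 0 on darts outside the model is arbitrary; the conclusions concern darts in use
   only. *)
pose H d : rat := if [pick x | f x == d] is Some x then h x else 0%R.
have Hf x : H (f x) = h x.
  by rewrite /H; case: pickP => [y /eqP /fi -> //|/(_ x)]; rewrite eqxx.
exists H; split=> d /fim[x <-].
  by rewrite -(models_phi fs fa) !Hf hphi.
by rewrite -fs !Hf -hg.
Qed.

Lemma rot_letter w c : wf w -> c \in w -> exists i X Y, rot i w = c :: X ++ bar c :: Y.
Proof.
move=> wfw cw; have [i s e] := rot_to cw; have : bar c \in rot i w by rewrite mem_rot wf_bar.
rewrite e inE (negbTE (bar_neq c)) /= => /mem_split[X [Y eY]].
by exists i, X, Y; rewrite e eY.
Qed.

(** A potential takes equal values at two corners in the same face. The two loops at [u] single out
    the corners in-false and out-false respectively. The remaining opposite pair is separated by the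
    loop of a crossing [v] interlaced with [u], since that loop passes [u] exactly once. *)
Lemma good_corners_distinct w : good w -> corners_distinct w.
Proof.
move=> [wfw w0 pw iw] x y xw exy; apply: contra => hy.
have uw := wf_uniq wfw; have [p mp] := planar_model wfw w0 pw.
have orb h : (forall d, d.1 \in w -> h (dphi w d) = h d :> rat) -> h y = h x.
  move=> hh; apply: porbit_invariant hy => z hz; rewrite wphiE // hh //.
  move: z hz; apply: (porbit_closed (P := fun z => z.1 \in w)) => // z.
  by rewrite wphiE // mem_dphi.
(* one potential for each loop cut off by a crossing [c] *)
have pot c : c \in w -> exists (h : T * bool * bool -> rat) E,
   [/\ h y = h x, (forall d, d.1 \in w -> h d - h (dsig d) = jump w E d)%R,
       (E c /\ ~~ E (bar c)), (forall l, l \in w -> E (prev w l) = (l != c) && ((l == bar c) || E l))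
     & forall v, v != c.1 -> il w c.1 v = E (v, true) (+) E (v, false)].
  move=> cw; have [i [X [Y e]]] := rot_letter wfw cw.
  have wfr : wf (c :: X ++ bar c :: Y) by rewrite -e wf_rot.
  have := models_rot i wfw mp; rewrite e => mr.
  have [h [h1 h2]] := loop_potential wfr mr.
  have [n1 _ n3 _] := notin_smooth wfr.
  have er d : dphi (c :: X ++ bar c :: Y) d = dphi w d by rewrite -e /dphi dalp_rot.
  have ep l : prev (c :: X ++ bar c :: Y) l = prev w l by rewrite -e prev_rot.
  have em l : (l \in w) = (l \in c :: X ++ bar c :: Y) by rewrite -e mem_rot.
  exists h, (mem (c :: X)); split.
  - by apply: orb => d dw; rewrite -er h1 -?em.
  - by move=> d dw; rewrite h2 -?em // /jump ep.
  - by rewrite /= mem_head inE negb_or bar_neq n3.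
  - move=> l lw; rewrite /= -ep arc_prev -?em // inE.
    by case: eqP.
  - move=> v vc; rewrite -(il_rot i) // e il_center // /oddX /= !inE.
    by case: (c) vc => u b /= vc; rewrite !xpair_eqE (negbTE vc).
case: x y xw exy {hy} orb pot => [[u b] o] [[u' b'] o'] /= xw <- _ pot.
have uu : u \in labels w by rewrite -(mem_wf (u, b)).
have inw b1 : (u, b1) \in w by rewrite mem_wf.
have [v uv] := iw u uu; have vu : v != u by apply: contraTneq uv => ->; rewrite il_irr.
have vw : (v, true) \in w.
  by rewrite mem_wf //=; apply: (@il_unused _ _ v u); rewrite // il_sym.
have vals (h : T * bool * bool -> rat) E : (forall d, d.1 \in w -> h d - h (dsig d) = jump w E d)%R ->
  (h ((u, true), true) - h ((u, false), false) = (E (u, true))%:R /\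
   h ((u, false), false) - h ((u, true), false) = - (E (prev w (u, false)))%:R /\
   h ((u, true), false) - h ((u, false), true) = - (E (prev w (u, true)))%:R /\
   h ((u, false), true) - h ((u, true), true) = (E (u, false))%:R)%R.
  move=> H; have := H ((u, true), true) (inw _); have := H ((u, false), false) (inw _).
  have := H ((u, true), false) (inw _); have := H ((u, false), true) (inw _).
  by rewrite /dsig /bar /jump /=.
have [h1 [E1 [e1 q1 [r1 s1] t1 _]]] := pot _ (inw true).
have [h2 [E2 [e2 q2 [r2 s2] t2 _]]] := pot _ (inw false).
have [h3 [E3 [e3 q3 [r3 s3] t3 i3]]] := pot _ vw.
have := vals _ _ q1; rewrite !t1 // r1 (negbTE s1) !eqxx /= => -[a1 [a2 [a3 a4]]].
have := vals _ _ q2; rewrite !t2 // r2 (negbTE s2) !eqxx /= => -[b1 [b2 [b3 b4]]].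
have E3' := i3 u; rewrite eq_sym vu /= il_sym // uv in E3'.
have := vals _ _ q3; rewrite !t3 // !xpair_eqE eq_sym (negbTE vu) /=.
have {E3'} := E3' isT.
case: (E3 (u, true)); case: (E3 (u, false)) => //= _ -[c1 [c2 [c3 c4]]];
  rewrite ?xpair_eqE /= ?(negbTE vu) ?andbF ?andbT /= in a1 a2 a3 a4 b1 b2 b3 b4 c1 c2 c3 c4;
  clear pot; rewrite ?xpair_eqE eqxx; case: b b' o o' e1 e2 e3 {xw} => [] [] [] [] //= e1 e2 e3;
  exfalso; lra.
Qed.

(** If [u] is isolated, the loop [X] contains both passages of each of its crossings. A face started
    at a corner of [u] towards the loop cannot leave [X] except at another corner of [u], which
    distinctness forbids; so it would never return to its start. *)
Lemma corners_distinct_no_isolated w : wf w -> corners_distinct w -> no_isolated w.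
Proof.
move=> wfw cd u uu; have uw := wf_uniq wfw.
case: (boolP [exists v, il w u v]) => [/existsP //|/existsPn iso]; exfalso.
pose c := (u, true); have cw : c \in w by rewrite mem_wf.
have [i [X [Y e]]] := rot_letter wfw cw.
have wfr : wf (c :: X ++ bar c :: Y) by rewrite -e wf_rot.
have oX v : oddX X v = false by rewrite -(il_center wfr) -e il_rot // (negbTE (iso v)).
have bX l : l \in X -> bar l \in X.
  by have := oX l.1; rewrite /oddX; case: l => v [] /=; rewrite /bar /=; case: (_ \in X); case: (_ \in X).
have [n1 n2 n3 n4] := notin_smooth wfr.
set r := c :: X ++ bar c :: Y in e wfr; have ur := wf_uniq wfr.
have er d : dphi w d = dphi r d by rewrite -e /dphi dalp_rot.
have step d : d = (c, true) \/ d.1 \in X -> 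
   (dphi r d).1 \in X \/ (dphi r d).1.1 = u /\ dphi r d != (c, true).
  move=> hd; have hE : d.1 \in c :: X by case: hd => [->|h]; rewrite inE ?eqxx ?h ?orbT.
  have dr : d.1 \in r by move: hE; rewrite /r !inE mem_cat => /orP[->|->]; rewrite ?orbT.
  case: d hd hE dr => l []; rewrite /dphi ?dalp_out ?dalp_in [_.1]/= => hd hE lr.
    have := @arc_prev c X Y (next r l) wfr; rewrite -/r mem_next prev_next // => /(_ lr).
    rewrite hE; case/esym/andP => _ /orP[/eqP ->|h].
      by right; rewrite /dsig /bar /c /= !xpair_eqE ?andbF.
    by left; rewrite /dsig /=; apply: bX.
  have lX : l \in X by case: hd => // -[].
  have := arc_prev wfr lr; rewrite -/r lX orbT andbT => h.
  have : prev r l \in c :: X by rewrite h; apply: contraNneq n1 => <-.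
  rewrite inE => /orP[/eqP ->|h'].
    by right; rewrite /dsig /bar /c /= !xpair_eqE ?andbF.
  by left; rewrite /dsig /=; apply: bX.
(* the face at the corner [(c, true)] would stay inside the loop [X] forever *)
have orb k : k = 0 \/ (iter k (wphi w) (c, true)).1 \in X.
  elim: k => [|k IH]; [by left|right; rewrite iterS wphiE // er].
  have hd : iter k (wphi w) (c, true) = (c, true) \/ (iter k (wphi w) (c, true)).1 \in X.
    by case: IH => [->|]; [left|right].
  case: (step _ hd) => // -[e1 e2]; exfalso.
  have := cd (c, true) _ cw (esym e1); rewrite eq_sym e2 => /(_ isT) /negP; apply.
  by rewrite -er -wphiE // -iterS -permX mem_porbit.
have := orb #|porbit (wphi w) (c, true)|; rewrite iter_porbit /= (negbTE n1).
by case=> // e0; have := card_porbit_neq0 (wphi w) (c, true); rewrite e0.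
Qed.

End Corners.

(** * Moves *)

Section Moves.
Variable T : finType.
Implicit Types (l m c : T * bool) (w X Y : seq (T * bool)) (d : T * bool * bool) (u v : T).

Lemma invA_flip p q c X Y : let w := c :: X ++ bar c :: Y in
  wf w -> X != [::] -> Y != [::] -> models p w -> models q (flip X Y) -> invA (NT p) (NT q).
Proof.
move=> w wfw X0 Y0 [f [fi fim fs fa]] [g [gi gim gs ga]].
pose e b o := (((c.1, b), o) : T * bool * bool).
have cw b : (c.1, b) \in w by rewrite in_smooth //= eqxx.
(* From this base dart [tau] pairs the two incoming darts and the two outgoing ones, as [skip]
   does. *)
have [b fb] : exists b, f b = e false false by apply/fim; exact: cw.
pose s := ksig p.
have s4 : s (s (s (s b))) = b by have [] := kproj_deg4 b.
have fb1 : f (s b) = e true false by rewrite fs fb.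
have fb2 : f (s (s b)) = e false true by rewrite fs fb1.
have fb3 : f (s (s (s b))) = e true true by rewrite fs fb2.
have ee b1 o1 b2 o2 : (e b1 o1 == e b2 o2) = (b1 == b2) && (o1 == o2).
  by rewrite /e !xpair_eqE eqxx.
have atE x : at_v b x = ((f x).1.1 == c.1).
  rewrite /at_v mem_porbit4 // !inE -!(inj_eq fi) -/s fb fb1 fb2 fb3.
  case: (f x) => [[u b'] o]; rewrite /e !xpair_eqE /=.
  by case: eqP => //= _; case: b'; case: o.
have tauE x : at_v b x -> f (tau b x) = (bar (f x).1, (f x).2).
  rewrite atE /tau -/s => /eqP ex; rewrite -!(inj_eq fi) fb fb1 fb2 fb3.
  have -> : f x = e (f x).1.2 (f x).2 by rewrite /e -ex; case: (f x) => [[? ?] ?].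
  by case: (f x).1.2; case: (f x).2; rewrite !ee /=.
have fw x : (f x).1 \in w by apply/fim; exists x.
have aout x : at_v b x -> ~~ at_v b (kalp p x).
  rewrite !atE fa => /eqP hx; apply: (smooth_label wfw).
  exact: dalp_center.
have Fex x : exists y, theta X (f y) == g x.
  have /mapP[l lv el] : (g x).1 \in flip X Y by apply/gim; exists x.
  have /fim[y hy] : (l, (g x).2 (+) (l \in X)).1 \in w by rewrite in_smooth //= lv orbT.
  exists y; rewrite hy /theta /= -el -addbA addbb addbF.
  by case: (g x).
pose F x := xchoose (Fex x).
have FE x : theta X (f (F x)) = g x by apply/eqP; exact: (xchooseP (Fex x)).
have inj y z : theta X (f y) = theta X (f z) -> y = z by move=> /theta_inj /fi.
have Fout x : (f (F x)).1 \in rev X ++ Y.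
  have : (g x).1 \in flip X Y by apply/gim; exists x.
  by rewrite -FE /= mem_flip.
exists b; split.
  move=> x hx; apply/eqP => h; have := aout _ hx; rewrite h atE tauE //=.
  by rewrite -atE hx.
(* [q] has a dart, and it comes from a fifth dart of [p] away from the smoothed crossing. *)
have ncard : #|kd p| == 4 = false.
  apply/negP => /eqP h4.
  have [x _] : exists x : kd q, x \in kd q by apply/card_gt0P; exact: kproj_nonempty.
  have nx : ~~ at_v b (F x) by rewrite atE (smooth_label wfw).
  have u4 : uniq (F x :: [:: b; s b; s (s b); s (s (s b))]).
    have [_ [n1 n2]] := kproj_deg4 b; rewrite cons_uniq uniq_orbit4 // andbT.
    by rewrite -mem_porbit4.
  by have := max_card (mem (F x :: [:: b; s b; s (s b); s (s (s b))])); rewrite (card_uniqP u4) h4.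
rewrite ncard; exists q; split=> //; exists F; split; last split; last split.
- by move=> x y h; apply: gi; rewrite -!FE h.
- move=> y; rewrite atE; split.
    move=> hy; have : (f y).1 \in rev X ++ Y.
      by have := fw y; rewrite in_smooth // (negbTE hy).
    move=> h; have /gim[x hx] : (theta X (f y)).1 \in flip X Y by rewrite mem_flip.
    by exists x; apply: inj; rewrite FE hx.
  by move=> [x <-]; apply: (smooth_label wfw).
- by move=> x; apply: inj; rewrite FE gs -FE -theta_sig -fs.
- move=> x; apply: inj; rewrite FE ga -FE (dalp_smooth wfw) // -/w -fa; congr (theta X _).
  rewrite /sm_alpha /skip -atE; case ha: (at_v b (kalp p (F x))) => //=.
  have ht : at_v b (tau b (kalp p (F x))) by rewrite atE tauE //= -atE.
  by rewrite (aout _ ht) (fa (tau _ _)) tauE.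
Qed.

Definition trefoil_reach w := forall p, models p w ->
  exists t : kproj, is_trefoil t /\ reach kstep preduced (NT t) (NT p).

Lemma trefoil_reach_rot i w : wf w -> trefoil_reach (rot i w) -> trefoil_reach w.
Proof. by move=> wfw h p mp; apply: h; exact: models_rot. Qed.

Section Smooth.
Variables (c : T * bool) (X Y : seq (T * bool)).
Let w := c :: X ++ bar c :: Y.

Lemma arcs_nonempty v : wf w -> oddX X v -> X != [::] /\ Y != [::].
Proof.
move=> wfw ov; have X0 : X != [::] by apply: contraTneq ov => ->.
split=> //; apply/eqP => Y0.
have [b h1 h2] : exists2 b, (v, b) \in X & (v, ~~ b) \notin X.
  move: ov; rewrite /oddX; case h1: ((v, true) \in X); case h2: ((v, false) \in X) => //= _.
    by exists true; rewrite ?h2.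
  by exists false; rewrite ?h1.
have : bar (v, b) \in w by rewrite wf_bar // in_smooth // mem_cat mem_rev h1 orbT.
have nv : v != c.1 by apply: (smooth_label wfw (l := (v, b))); rewrite mem_cat mem_rev h1.
by rewrite in_smooth // mem_cat mem_rev Y0 /bar /= (negbTE nv) (negbTE h2).
Qed.

(** [kstep] is symmetric, so reachability transfers both ways. The intermediate projection exists
    because every good word is realized, and it is reduced because its corners are distinct. *)
Lemma flip_step : good w -> good (flip X Y) ->
  (trefoil_reach w -> trefoil_reach (flip X Y)) /\
  (trefoil_reach (flip X Y) -> trefoil_reach w).
Proof.
move=> gw gf; have [wfw w0 pw iw] := gw; have [wff f0 pf jf] := gf.
have [v] : exists v, il w c.1 v by apply: iw; rewrite -mem_wf ?mem_head.
rewrite il_center // => /(arcs_nonempty wfw)[X0 Y0].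
have [p0 mp0] := planar_model wfw w0 pw.
have [q0 mq0] := planar_model wff f0 pf.
split=> h.
  move=> q mq; have [t [tt tr]] := h _ mp0; exists t; split=> //.
  apply: reachS tr _ _; first by right; exact: (invA_flip wfw).
  by apply/(models_reduced wff mq); exact: good_corners_distinct.
move=> p mp; have [t [tt tr]] := h _ mq0; exists t; split=> //.
apply: reachS tr _ _; first by left; exact: (invA_flip wfw).
by apply/(models_reduced wfw mp); exact: good_corners_distinct.
Qed.

(** After the local complementation a neighbour [u] of [c] is adjacent to those [v] with
    [il w u v != il w c v], so only a true twin of [c] could become isolated. Other vertices keep
    their neighbours. *)
Lemma good_flip : good w ->
  (forall u, il w c.1 u -> exists v, [/\ v != u, v != c.1 & il w u v != il w c.1 v]) ->
  good (flip X Y).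
Proof.
move=> gw nt; have [wfw w0 pw iw] := gw.
have [v0] : exists v, il w c.1 v by apply: iw; rewrite -mem_wf ?mem_head.
rewrite il_center // => /(arcs_nonempty wfw)[X0 Y0].
have wff := wf_flip wfw; split=> //.
- rewrite /flip -size_eq0 size_map size_cat size_rev addn_eq0 !size_eq0 negb_and X0 //.
- rewrite /planar (card_faces_smooth wfw) //.
  by apply: (good_corners_distinct gw); rewrite ?xpair_eqE ?andbF //= -/w in_smooth //= eqxx.
- move=> u; rewrite (labels_flip wfw) !inE => /andP[uc uw].
  case cu: (il w c.1 u).
    have [v [vu vc hv]] := nt u cu; exists v.
    by rewrite (il_flip wfw) // 1?eq_sym // -/w cu /=; case: (il w u v) hv; case: (il w c.1 v).
  have [|v hv] := iw u; first by rewrite inE.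
  exists v; rewrite (il_flip wfw) // -/w ?cu ?addbF //.
    by apply: contraTneq hv => ->; rewrite il_irr.
  by apply: contraTneq hv => ->; rewrite il_sym ?cu.
Qed.

End Smooth.

Lemma smooth_move w (c : T) : good w -> c \in labels w ->
  (forall u, il w c u -> exists v, [/\ v != u, v != c & il w u v != il w c v]) ->
  exists w', [/\ good w', trefoil_reach w' -> trefoil_reach w, labels w' = labels w :\ c &
    forall p q, p != q -> p != c -> q != c -> il w' p q = il w p q (+) (il w c p && il w c q)].
Proof.
move=> gw cw nt; have [wfw _ _ _] := gw.
have [|i [X [Y e]]] := @rot_letter _ w (c, true) wfw; first by rewrite mem_wf.
have gr : good ((c, true) :: X ++ bar (c, true) :: Y) by rewrite -e; apply/good_rot.
have [wfr _ _ _] := gr.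
have ir p q : il ((c, true) :: X ++ bar (c, true) :: Y) p q = il w p q by rewrite -e il_rot.
have gf : good (flip X Y).
  by apply: (good_flip gr) => u; rewrite /= ir => /nt[v [h1 h2 h3]]; exists v; rewrite !ir.
exists (flip X Y); split=> //.
- move=> h; apply: (@trefoil_reach_rot i) => //; rewrite e.
  exact: (proj2 (flip_step gr gf)).
- by rewrite (labels_flip wfr) -e labels_rot.
- by move=> p q pq pc qc; rewrite (il_flip wfr) // !ir.
Qed.

Section Insert.
Variables (c : T * bool) (X Y : seq (T * bool)).
Hypotheses (gw : good (X ++ Y)) (cw : c.1 \notin labels (X ++ Y)).
Let W := insert c X Y.

(** Planarity of [W] comes from [card_faces_smooth] at the new crossing. Since [W] is not yet known
    to be reduced, the separation of the two corners is a hypothesis. An old crossing interlaced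
    with the new one has it as a neighbour; any other keeps a neighbour. *)
Lemma insert_move v : oddX X v ->
  ((c.1, false), false) \notin porbit (wphi W) ((c.1, false), true) ->
  [/\ good W, trefoil_reach W -> trefoil_reach (X ++ Y), labels W = c.1 |: labels (X ++ Y),
    (forall p, il W c.1 p = oddX X p) &
    forall p q, p != q -> p != c.1 -> q != c.1 ->
      il W p q = il (X ++ Y) p q (+) (oddX X p && oddX X q)].
Proof.
move=> ov hf; have [wfw w0 pw iw] := gw.
have wfW : wf W by exact: wf_insert.
have inew p : il W c.1 p = oddX X p by exact: il_insert_new.
have iold p q : p != q -> p != c.1 -> q != c.1 ->
    il W p q = il (X ++ Y) p q (+) (oddX X p && oddX X q) by exact: il_insert.
have uW : labels W = c.1 |: labels (X ++ Y) by exact: labels_insert.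
have ov' : oddX (map (tog X) (rev X)) v by rewrite oddX_insert.
have [X0 Y0] := arcs_nonempty wfW ov'.
have gW : good W.
  split=> //.
  - by rewrite /planar -(card_faces_smooth wfW) // flip_insert.
  - move=> u; rewrite uW in_setU1; case: (eqVneq u c.1) => [-> _|uc /= uw].
      by exists v; rewrite inew.
    have [v' hv'] := iw u uw.
    have vc : v' != c.1.
      by apply: contraNneq cw => <-; apply: (@il_unused _ _ v' u); rewrite // il_sym.
    have uv : u != v' by apply: contraTneq hv' => ->; rewrite il_irr.
    case hu: (oddX X u); last by exists v'; rewrite iold // hv' hu.
    by exists c.1; rewrite il_sym // inew.
split=> // h.
have gf : good (flip (map (tog X) (rev X)) (map (tog X) Y)) by rewrite flip_insert.
by have := proj1 (flip_step gW gf) h; rewrite flip_insert.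
Qed.

End Insert.

(** Two opposite corners with different flags are separated once one of them is seen to lie in a
    short face of constant flag. *)
Lemma flag_orbit W (o : bool) (C : seq (T * bool * bool)) x y : uniq W ->
  (forall d, d \in C -> dphi W d \in C) -> all (fun d => d.2 == o) C ->
  x \in C -> y.2 != o -> y \notin porbit (wphi W) x.
Proof.
move=> uW cl fl xC yo; apply: contra yo => hy.
have : y \in C.
  apply: (porbit_closed (P := mem C)) hy => // z zC; rewrite wphiE //; exact: cl.
by move/(allP fl).
Qed.

(** The last clause follows an edge away from [v]: its ends stay consecutive, possibly in the other
    order, and an end changes sign exactly when it is interlaced with [v]. This is how
    [step_two_cliques] corrects a sign. *)
Lemma twin_move w v (c : T) : good w -> v \in labels w -> c \notin labels w ->
  exists w', [/\ good w', trefoil_reach w' -> trefoil_reach w, labels w' = c |: labels w,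
   (forall p, il w' c p = il w v p) /\
   (forall p q, p != q -> p != c -> q != c -> il w' p q = il w p q (+) (il w v p && il w v q)) &
   forall l m, l \in w -> next w l = m -> l.1 != v -> m.1 != v ->
    let l' := (l.1, l.2 (+) il w v l.1) in let m' := (m.1, m.2 (+) il w v m.1) in
    (l' \in w' /\ m' \in w') /\ (next w' l' = m' \/ next w' m' = l')].
Proof.
move=> gw vw cw; have [wfw _ _ iw] := gw.
pose v1 := (v, true).
have [|i [A [B e]]] := @rot_letter _ w v1 wfw; first by rewrite mem_wf.
set r := v1 :: A ++ bar v1 :: B in e.
have gr : good r by rewrite -e; apply/good_rot.
have [wfr _ _ _] := gr; have ur := wf_uniq wfr.
(* With [v1] moved to the end, the new crossing is placed just before [bar v1] and, cyclically, just
   after [v1]; the two crossings then bound a bigon. *)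
have e2 : A ++ (bar v1 :: B ++ [:: v1]) = rot 1 r by rewrite /r rot1_cons -cats1 -!catA.
pose Y := bar v1 :: B ++ [:: v1].
have gAY : good (A ++ Y) by rewrite e2; apply/good_rot.
have [wfAY _ _ _] := gAY.
have oA p : oddX A p = il w v p by rewrite -(il_center wfr) -/r -e il_rot.
have uAY : labels (A ++ Y) = labels w by rewrite e2 labels_rot -e labels_rot.
have iAY p q : il (A ++ Y) p q = il w p q by rewrite e2 il_rot // -e il_rot.
have cAY : (c, false).1 \notin labels (A ++ Y) by rewrite uAY.
have [v0 hv0] := iw v vw; rewrite -oA in hv0.
have tv b : tog A (v, b) = (v, b) by rewrite /tog /= oA il_irr addbF.
have WE : insert (c, false) A Y =
    (c, false) :: (map (tog A) (rev A) ++ (c, true) :: (v, false) :: map (tog A) B ++ [:: v1]).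
  by rewrite /insert /Y /bar /= map_cat /= !tv.
have uW := wf_uniq (wf_insert wfAY cAY).
have n1 : prev (insert (c, false) A Y) (c, false) = v1.
  by rewrite WE in uW *; have [_ ->] := adj_last uW; rewrite last_cat /= last_cat.
have n2 : prev (insert (c, false) A Y) (v, false) = (c, true).
  rewrite WE in uW *.
  by have [] := @adj_cat _ ((c, false) :: map (tog A) (rev A)) (c, true) (v, false) (map (tog A) B ++ [:: v1]).
(* the bigon between [v] and [c] is a face with only incoming darts *)
have faces : (((c, false).1, false), false) \notin
     porbit (wphi (insert (c, false) A Y)) (((c, false).1, false), true).
  rewrite porbit_sym.
  apply: (@flag_orbit _ false [:: ((c, false), false); ((v, false), false)]) => //.
    by move=> d; rewrite !inE => /orP[] /eqP ->; rewrite /dphi dalp_in ?n1 ?n2 /dsig /bar /= eqxx ?orbT.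
  by rewrite inE eqxx.
have [gW rW uW' inew iold] := insert_move gAY cAY hv0 faces.
exists (insert (c, false) A Y); split=> //.
- move=> h; apply: (@trefoil_reach_rot i) => //; rewrite e.
  by apply: (@trefoil_reach_rot 1) => //; rewrite -e2; exact: rW.
- by rewrite uW' uAY.
- by split=> [p|p q pq pc qc]; [rewrite inew oA|rewrite iold // iAY !oA].
move=> l m lw nlm lv mv l' m'; rewrite /l' /m' -!oA {l' m'}.
rewrite -[(l.1, _)]/(tog A l) -[(m.1, _)]/(tog A m).
have mw : m \in w by rewrite -nlm mem_next.
have used k : k \in w -> tog A k \in insert (c, false) A Y.
  move=> kw; have [wfW _ _ _] := gW; rewrite mem_wf // uW' uAY in_setU1 /=.
  by rewrite -mem_wf // kw orbT.
split; first by split; exact: used.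
rewrite -(next_rot i) ?wf_uniq // e in nlm.
have lr : l \in r by rewrite -e mem_rot.
move: (lr); rewrite /r inE mem_cat inE => /or4P[/eqP h|lA|/eqP h|lB].
- by rewrite h eqxx in lv.
- right; have [A1 [A2 eA]] := mem_split lA.
  case: A2 eA => [|k A2] eA.
    have er : r = (v1 :: A1) ++ l :: bar v1 :: B by rewrite /r eA -catA.
    have [hn _] : next r l = bar v1 /\ true.
      by rewrite er; have [] := @adj_cat _ (v1 :: A1) l (bar v1) B; rewrite -?er.
    by rewrite -nlm hn eqxx in mv.
  have er : r = (v1 :: A1) ++ l :: k :: (A2 ++ bar v1 :: B) by rewrite /r eA -catA.
  have ek : m = k.
    rewrite -nlm er; have [] := @adj_cat _ (v1 :: A1) l k (A2 ++ bar v1 :: B); rewrite -?er //.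
  rewrite ek; have eW : insert (c, false) A Y = ((c, false) :: map (tog A) (rev A2)) ++
      tog A k :: tog A l :: (map (tog A) (rev A1) ++ (c, true) :: map (tog A) Y).
    by rewrite /insert {2}eA rev_cat !rev_cons -!cats1 !map_cat /= -!catA.
  rewrite eW; have [] := @adj_cat _ ((c, false) :: map (tog A) (rev A2)) (tog A k) (tog A l)
     (map (tog A) (rev A1) ++ (c, true) :: map (tog A) Y); rewrite -?eW //.
- by rewrite h eqxx in lv.
- left; have [B1 [B2 eB]] := mem_split lB.
  case: B2 eB => [|k B2] eB.
    have hn : next r l = v1.
      have -> : l = last v1 (A ++ bar v1 :: B) by rewrite last_cat eB /= last_cat.
      by have [] := adj_last ur.
    by rewrite -nlm hn eqxx in mv.
  have er : r = (v1 :: A ++ bar v1 :: B1) ++ l :: k :: B2 by rewrite /r eB /= -catA.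
  have ek : m = k.
    rewrite -nlm er; have [] := @adj_cat _ (v1 :: A ++ bar v1 :: B1) l k B2; rewrite -?er //.
  rewrite ek; have eW : insert (c, false) A Y =
      ((c, false) :: map (tog A) (rev A) ++ (c, true) :: tog A (bar v1) :: map (tog A) B1) ++
      tog A l :: tog A k :: (map (tog A) B2 ++ [:: tog A v1]).
    by rewrite /insert /Y eB /= !map_cat /= -!catA.
  rewrite eW; have [] := @adj_cat _
     ((c, false) :: map (tog A) (rev A) ++ (c, true) :: tog A (bar v1) :: map (tog A) B1)
     (tog A l) (tog A k) (map (tog A) B2 ++ [:: tog A v1]); rewrite -?eW //.
Qed.

(** Write the cyclic word as [l m A (bar m) B (bar l) C]. The splice reverses [B], and a label
    occurs once in [B] exactly when it is interlaced with one of [l.1], [m.1] but not both. Opposite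
    signs make [d] and the edge from [l] to [m] bound a triangle. *)
Lemma triangle_move w l m (d : T) v : good w -> l \in w -> next w l = m -> m.2 = ~~ l.2 ->
  l.1 != m.1 -> ~~ il w l.1 m.1 -> d \notin labels w -> il w l.1 v != il w m.1 v ->
  exists w', [/\ good w', trefoil_reach w' -> trefoil_reach w, labels w' = d |: labels w,
   (forall p, il w' d p = il w l.1 p (+) il w m.1 p) &
   (forall p q, p != q -> p != d -> q != d -> il w' p q =
     il w p q (+) ((il w l.1 p (+) il w m.1 p) && (il w l.1 q (+) il w m.1 q)))].
Proof.
move=> gw lw nlm sg lm nil dw hv; have [wfw _ _ iw] := gw.
have [i [X0 [C e]]] := rot_letter wfw lw.
set r := l :: X0 ++ bar l :: C in e.
have gr : good r by rewrite -e; apply/good_rot.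
have [wfr _ _ _] := gr; have ur := wf_uniq wfr.
have ir p q : il r p q = il w p q by rewrite -e il_rot.
have nr : next r l = m by rewrite -e next_rot // wf_uniq.
have [X1 eX0] : exists X1, X0 = m :: X1.
  case: X0 @r e gr wfr ur ir nr => [|k X1] r e gr wfr ur ir nr.
    have [h _] : next r l = bar l /\ true.
      by rewrite /r /=; rewrite eqxx.
    by rewrite -nr h eqxx in lm.
  by exists X1; rewrite -nr /r /= eqxx.
(* As [m.1] is not interlaced with [l.1], both its passages lie on the same arc. *)
have bm : bar m \in X1.
  have := il_center wfr m.1; rewrite -/r ir (negbTE nil) eX0 /oddX.
  have : bar m != m by exact: bar_neq.
  have : m \in m :: X1 by exact: mem_head.
  case: (m) => y [] /=; rewrite /bar /= => -> hb; rewrite inE (negbTE hb) /=.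
    by case: (_ \in _).
  by case: (_ \in _).
have [A [B eX1]] := mem_split bm.
have rE : r = l :: m :: A ++ bar m :: (B ++ bar l :: C) by rewrite /r eX0 eX1 /= -catA.
pose Y := bar l :: C ++ l :: m :: A ++ [:: bar m].
have e2 : B ++ Y = rot (size (l :: m :: A ++ [:: bar m])) r.
  have -> : r = (l :: m :: A ++ [:: bar m]) ++ (B ++ bar l :: C) by rewrite rE /= -catA.
  by rewrite rot_size_cat /Y -catA.
have gBY : good (B ++ Y) by rewrite e2; apply/good_rot.
have [wfBY _ _ _] := gBY.
have uBY : labels (B ++ Y) = labels w by rewrite e2 labels_rot -e labels_rot.
have iBY p q : il (B ++ Y) p q = il w p q by rewrite e2 il_rot.
have oB p : oddX B p = il w l.1 p (+) il w m.1 p.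
  have r1E : rot 1 r = m :: A ++ bar m :: (B ++ bar l :: C ++ [:: l]).
    by rewrite rE rot1_cons -cats1 /= -!catA /= -!catA.
  have wf1 : wf (rot 1 r) by rewrite wf_rot.
  have := il_center wfr p; rewrite -/r ir => ->.
  have : il (rot 1 r) m.1 p = oddX A p.
    by move: wf1; rewrite r1E => wf1; exact: il_center.
  rewrite il_rot // ir => ->.
  have uX0 : uniq X0 by move: ur; rewrite /r cons_uniq cat_uniq => /and4P[].
  move: (uX0); rewrite eX0 eX1 cons_uniq cat_uniq => /and3P[_ uA /and3P[_ _ uB]].
  rewrite !oddX_count // -?eX1 -?eX0 // eX0 eX1 /= map_cat count_cat /= !oddD !oddb.
  by case: (_ == _); do 2!case: odd.
have dBY (b : bool) : (d, b).1 \notin labels (B ++ Y) by rewrite uBY.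
have ov : oddX B v by rewrite oB; case: (il w l.1 v) hv; case: (il w m.1 v).
(* Neither end of the edge is interlaced with [d], so both keep their signs. *)
have tl k : k.1 = l.1 \/ k.1 = m.1 -> tog B k = k.
  move=> h; suff h' : il w l.1 k.1 (+) il w m.1 k.1 = false.
    by rewrite /tog oB h' addbF; case: (k).
  case: h => ->; rewrite ?il_irr ?addbF ?addFb.
    by rewrite il_sym // (negbTE nil).
  by rewrite (negbTE nil).
pose b := l.2.
have WE : insert (d, ~~ b) B Y = (d, ~~ b) :: (map (tog B) (rev B) ++ (d, b) :: bar l ::
    map (tog B) C ++ l :: m :: map (tog B) A ++ [:: bar m]).
  rewrite /insert /Y /bar /= negbK !map_cat /= !map_cat /=; rewrite -/(bar l) -/(bar m).
  by rewrite !tl; auto.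
have uW := wf_uniq (wf_insert wfBY (dBY (~~ b))).
set W := insert _ _ _ in WE uW.
have n1 : next W (bar m) = (d, ~~ b) /\ prev W (d, ~~ b) = bar m.
  have := adj_last; rewrite WE in uW * => /(_ _ _ _ uW).
  by rewrite last_cat /= last_cat /= last_cat.
have n2 : next W (d, b) = bar l /\ prev W (bar l) = (d, b).
  rewrite WE in uW *.
  by apply: (@adj_cat _ ((d, ~~ b) :: map (tog B) (rev B)) (d, b) (bar l)).
have n3 : next W l = m /\ prev W m = l.
  have EW : W = ((d, ~~ b) :: map (tog B) (rev B) ++ (d, b) :: bar l :: map (tog B) C) ++
     l :: m :: (map (tog B) A ++ [:: bar m]) by rewrite WE /= -catA.
  by rewrite EW in uW *; apply: adj_cat.
(* the triangle cut off by [d] is a face all of whose darts have the same flag *)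
have faces : (((d, ~~ b).1, false), false) \notin
     porbit (wphi W) (((d, ~~ b).1, false), true).
  have [q1 q2] := n1; have [q3 q4] := n2; have [q5 q6] := n3.
  have ml : m.2 = ~~ b by [].
  case eb: b in q1 q2 q3 q4 ml *.
    rewrite porbit_sym.
    apply: (@flag_orbit _ false [:: (m, false); (bar l, false); ((d, false), false)]) => //.
      move=> k; rewrite !inE => /or3P[] /eqP ->; rewrite /dphi dalp_in ?q2 ?q4 ?q6.
      - by rewrite /dsig /= -/b eb eqxx orbT.
      - by rewrite /dsig /bar /= eqxx !orbT.
      - by rewrite /dsig barK /= ml eqxx.
    by rewrite !inE eqxx !orbT.
  apply: (@flag_orbit _ true [:: (l, true); (bar m, true); ((d, false), true)]) => //.
    move=> k; rewrite !inE => /or3P[] /eqP ->; rewrite /dphi dalp_out ?q1 ?q3 ?q5.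
    - by rewrite /dsig /= ml eqxx orbT.
    - by rewrite /dsig /bar /= eqxx !orbT.
    - by rewrite /dsig barK /= -/b eb eqxx.
  by rewrite !inE eqxx !orbT.
have [gW rW uW' inew iold] := insert_move gBY (dBY _) ov faces.
exists W; split=> //.
- move=> h; apply: (@trefoil_reach_rot i) => //; rewrite e.
  by apply: (@trefoil_reach_rot (size (l :: m :: A ++ [:: bar m]))) => //; rewrite -e2; exact: rW.
- by rewrite uW' uBY.
- by move=> p; rewrite inew oB.
- by move=> p q pq pd qd; rewrite iold // iBY !oB.
Qed.

End Moves.

(** * Reduction *)

#[local] Hint Extern 0 (is_true (negb (eq_op _ _))) => (rewrite eq_sym; assumption) : core.

Section Reduction.
Variable T : finType.
Implicit Types (l m : T * bool) (w : seq (T * bool)) (c u v x y z : T).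

Definition twinless w c :=
  forall u, il w c u -> exists v, [/\ v != u, v != c & il w u v != il w c v].

Definition twins w u v := il w u v /\ forall z, z != u -> z != v -> il w u z = il w v z.

Definition twinb w c :=
  [exists u, il w c u && [forall v, (v != u) && (v != c) ==> (il w u v == il w c v)]].

Lemma twinbP w c : reflect (exists u, twins w c u) (twinb w c).
Proof.
apply: (iffP existsP) => -[u].
  move=> /andP[cu /forallP h]; exists u; split=> // z zc zu.
  by have := h z; rewrite zc zu => /eqP ->.
move=> [cu h]; exists u; rewrite cu; apply/forallP => v; apply/implyP => /andP[vu vc].
by rewrite h.
Qed.

Lemma twinbPn w c : ~~ twinb w c -> twinless w c.
Proof.
move=> /existsPn h u cu; have := h u; rewrite cu /= => /forallPn[v].
by rewrite negb_imply => /andP[/andP[vu vc] hv]; exists v.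
Qed.

Lemma il_neq w x y : il w x y -> x != y.
Proof. by case/andP. Qed.

Lemma card_labels_gt0 w : good w -> 0 < #|labels w|.
Proof.
case=> wfw w0 _ _; case: (w) w0 wfw => // l w' _ wfw; apply/card_gt0P; exists l.1.
by rewrite -mem_wf ?mem_head.
Qed.

(** Unoriented, because [twin_move] may reverse the edge. *)
Definition neighbours w l m := next w l = m \/ next w m = l.

(** Inserting [d] across the edge and smoothing both ends merges the two crossings into [d]. The
    complementations inside either neighbourhood cancel, and what remains is a toggle between the
    two neighbourhoods. *)
Lemma opposite_move w l m (d : T) : good w -> l \in w -> m \in w -> neighbours w l m ->
  m.2 = ~~ l.2 -> l.1 != m.1 -> ~~ il w l.1 m.1 ->
  (forall z, ~~ (il w l.1 z && il w m.1 z)) -> d \notin labels w ->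
  exists w', [/\ good w', trefoil_reach w' -> trefoil_reach w,
    labels w' = (d |: labels w) :\ l.1 :\ m.1,
    (forall p, p != l.1 -> p != m.1 -> p != d -> il w' d p = il w l.1 p (+) il w m.1 p) &
    (forall p q, p != q -> p != l.1 -> p != m.1 -> p != d -> q != l.1 -> q != m.1 -> q != d ->
      il w' p q = il w p q (+) (il w l.1 p && il w m.1 q) (+) (il w m.1 p && il w l.1 q))].
Proof.
move=> gw lw mw nb sg lm nil dis dw.
wlog nlm : l m lw mw nb sg lm nil dis / next w l = m.
  move=> H; case: (nb) => [h|h]; first exact: H.
  have [wfw _ _ _] := gw.
  have [||||||w' [h1 h2 h3 h4 h5]] := H m l mw lw.
  - by left.
  - by rewrite sg negbK.
  - by rewrite eq_sym.
  - by rewrite il_sym.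
  - by move=> z; rewrite andbC.
  - by [].
  exists w'; split=> //.
  - by rewrite h3; apply/setP => z; rewrite !inE andbCA.
  - by move=> p p1 p2 p3; rewrite h4 // addbC.
  - by move=> p q pq p1 p2 p3 q1 q2 q3; rewrite h5 // -!addbA; congr (_ (+) _); rewrite addbC.
have [wfw _ _ iw] := gw.
set x := l.1 in lm nil dis *; set y := m.1 in lm nil dis *.
have xw : x \in labels w by rewrite -mem_wf.
have yw : y \in labels w by rewrite -mem_wf.
have xd : x != d by apply: contraNneq dw => <-.
have yd : y != d by apply: contraNneq dw => <-.
have yx : il w y x = false by rewrite il_sym // (negbTE nil).
have [v xv] := iw x xw.
have hv : il w x v != il w y v by have := dis v; rewrite xv /= => /negbTE ->.
have [w1 [g1 r1 u1 n1 i1]] := triangle_move gw lw nlm sg lm nil dw hv.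
rewrite -/x -/y in n1 i1; have [wf1 _ _ _] := g1.
have xE p : p != d -> il w1 x p = il w x p.
  move=> pd; case: (eqVneq x p) => [<-|xp]; first by rewrite !il_irr.
  by rewrite i1 // il_irr yx /= addbF.
have yE p : p != d -> il w1 y p = il w y p.
  move=> pd; case: (eqVneq y p) => [<-|yp]; first by rewrite !il_irr.
  by rewrite i1 // il_irr (negbTE nil) /= addbF.
have xd0 : il w1 x d = false by rewrite il_sym // n1 il_irr yx.
have yd0 : il w1 y d = false by rewrite il_sym // n1 il_irr (negbTE nil).
have [||w2 [g2 r2 u2 i2]] := @smooth_move _ w1 x g1.
- by rewrite u1 in_setU1 xw orbT.
(* By disjointness [d] is adjacent to every neighbour of [x] though not to [x], which excludes a
   true twin; it serves again for [y]. *)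
- move=> z xz; have zd : z != d by apply: contraTneq xz => ->; rewrite xd0.
  exists d; split; [by rewrite eq_sym|by rewrite eq_sym|].
  rewrite xd0 il_sym // n1; rewrite xE // in xz.
  by have := dis z; rewrite xz /= => /negbTE ->.
have [wf2 _ _ _] := g2.
have xy : x != y by [].
have yE2 p : p != d -> p != x -> il w2 y p = il w y p.
  move=> pd px; case: (eqVneq y p) => [<-|yp]; first by rewrite !il_irr.
  by rewrite i2 // // xE // (negbTE nil) addbF yE.
have yd2 : il w2 y d = false.
  by rewrite i2 // // xd0 andbF addbF yd0.
have dE2 p : p != x -> p != d -> il w2 d p = il w x p (+) il w y p.
  by move=> px pd; rewrite i2 // // xd0 addbF n1.
have [||w3 [g3 r3 u3 i3]] := @smooth_move _ w2 y g2.
- by rewrite u2 u1 !inE eq_sym xy /=; rewrite inE in yw; rewrite yw orbT.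
- move=> z yz; have zd : z != d by apply: contraTneq yz => ->; rewrite yd2.
  have zx : z != x.
    apply: contraTneq yz => ->; apply/negP => h.
    have := il_unused wf2 (_ : il w2 x y); rewrite il_sym // h => /(_ isT).
    by rewrite u2 !inE eqxx.
  exists d; split; [by rewrite eq_sym|by rewrite eq_sym|].
  rewrite yd2 il_sym // dE2 //; rewrite yE2 // in yz.
  by have := dis z; rewrite yz andbT => /negbTE ->.
exists w3; split=> //.
- by move=> h; apply/r1/r2/r3.
- by rewrite u3 u2 u1.
- by move=> p px py pd; rewrite i3 // // yd2 addbF dE2.
- move=> p q pq px py pd qx qy qd.
  rewrite i3 // i2 // i1 // !xE // !yE2 //.
  by case: (il w p q); case: (il w x p); case: (il w y p); case: (il w x q); case: (il w y q).
Qed.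

Section Step.
Variable w : seq (T * bool).
Hypotheses (gw : good w) (fresh : #|labels w| + 2 <= #|T|).
Hypothesis IH : forall w', good w' -> #|labels w'| < #|labels w| -> trefoil_reach w'.
Let wfw : wf w. Proof. by case: gw. Qed.
Local Notation e := (il w).

Lemma pick_fresh (A : {set T}) : #|A| < #|T| -> exists c, c \notin A.
Proof.
move=> h; have : 0 < #|~: A| by have := cardsC A; lia.
by case/card_gt0P => c; rewrite inE; exists c.
Qed.

Lemma fresh_label : exists c, c \notin labels w.
Proof. by apply: pick_fresh; apply: leq_trans fresh; rewrite addn2. Qed.

Lemma fresh_label2 c : exists2 d, d != c & d \notin labels w.
Proof.
have [|d] := @pick_fresh (c |: labels w); last by rewrite in_setU1 negb_or => /andP[]; exists d.
by apply: leq_trans fresh; rewrite cardsU1 addn2 ltnS -addn1 addnC leq_add2l leq_b1.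
Qed.

Lemma step_twinless c : c \in labels w -> twinless w c -> trefoil_reach w.
Proof.
move=> cw tc; have [w' [g' r' u' _]] := smooth_move gw cw tc.
by apply/r'/IH => //; rewrite u' (cardsD1 c (labels w)) cw.
Qed.

(* doubling [v] into [v] and [c], then smoothing [u] *)
Lemma twin_swap v u : twins w v u ->
  exists c w2, [/\ c \notin labels w, good w2, trefoil_reach w2 -> trefoil_reach w,
    labels w2 = (c |: labels w) :\ u &
    [/\ (forall p, p != v -> p != u -> p != c -> il w2 c p = e v p),
        (forall p, p != u -> p != c -> il w2 v p = e v p) &
        (forall p q, p != q -> p != v -> p != u -> p != c -> q != v -> q != u -> q != c ->
            il w2 p q = e p q (+) (e v p && e v q))]].
Proof.
move=> [vu tw]; have vw := il_unused wfw vu.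
have [c cw] := fresh_label.
have [w1 [g1 r1 u1 [n1 i1] _]] := twin_move gw vw cw; have [wf1 _ _ _] := g1.
have uw : u \in labels w by apply: (@il_unused _ _ u v); rewrite // il_sym.
have vc : v != c by apply: contraNneq cw => <-.
have uc : u != c by apply: contraNneq cw => <-.
have nvu := il_neq vu.
(* Complementing at [v] removes all common neighbours of the twins. Only [v] and [c] stay adjacent
   to [u], and they are not adjacent to each other, so [u] can be smoothed. *)
have uE p : p != v -> p != c -> il w1 u p = false.
  move=> pv pc; case: (eqVneq u p) => [<-|up]; first by rewrite il_irr.
  by rewrite i1 // vu -tw // addbb.
have uv1 : il w1 u v by rewrite i1 // // il_irr andbF addbF il_sym.
have uc1 : il w1 u c by rewrite il_sym // n1.
have vc1 : il w1 v c = false by rewrite il_sym // n1 il_irr.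
have vE p : p != c -> il w1 v p = e v p.
  move=> pc; case: (eqVneq v p) => [<-|vp]; first by rewrite !il_irr.
  by rewrite i1 // il_irr addbF.
have [||w2 [g2 r2 u2 i2]] := @smooth_move _ w1 u g1.
- by rewrite u1 in_setU1 uw orbT.
- move=> z uz; case: (eqVneq z v) => [->|zv].
    by exists c; rewrite vc1 uc1 eq_sym vc eq_sym uc.
  case: (eqVneq z c) => [->|zc]; last by rewrite uE in uz.
  by exists v; rewrite il_sym // vc1 uv1.
exists c, w2; split=> //.
- by move=> h; apply/r1/r2.
- by rewrite u2 u1.
split.
- by move=> p pv pu pc; rewrite i2 // (uE p) // andbF addbF n1.
- move=> p pu pc; case: (eqVneq v p) => [<-|vp]; first by rewrite !il_irr.
  by rewrite i2 // (uE p) // andbF addbF vE.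
- by move=> p q pq pv pu pc qv qu qc; rewrite i2 // uE // addbF i1.
Qed.

Lemma card_swap (A : {set T}) c u x : c \notin A -> u \in A -> x \in A -> x != u ->
  #|(c |: A) :\ u :\ x| < #|A|.
Proof.
move=> cA uA xA xu; have := cardsU1 c A; rewrite cA.
have := cardsD1 u (c |: A); have := cardsD1 x ((c |: A) :\ u).
by rewrite !in_setD1 !in_setU1 uA xA xu !orbT /=; lia.
Qed.

Lemma card_swap2 (A : {set T}) c d x y u : c \notin A -> d \notin A -> d != c ->
  x \in A -> y \in A -> u \in A -> x != y -> u != x -> u != y ->
  #|(d |: (c |: A)) :\ x :\ y :\ u| < #|A|.
Proof.
move=> cA dA dc xA yA uA xy ux uy.
have inB p : p \in A -> p \in d |: (c |: A) by rewrite !in_setU1 => ->; rewrite !orbT.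
have hx := cardsD1 x (d |: (c |: A)); rewrite inB // in hx.
have hy := cardsD1 y ((d |: (c |: A)) :\ x); rewrite in_setD1 inB // eq_sym xy in hy.
have hu := cardsD1 u ((d |: (c |: A)) :\ x :\ y).
rewrite !in_setD1 inB // uy ux in hu.
have := cardsU1 c A; have := cardsU1 d (c |: A).
rewrite cA in_setU1 negb_or dc dA; clear -hx hy hu; lia.
Qed.

(** Since [z0] is a neighbour but not a twin of [v], its own twin [z'] differs from [v] and [u] and
    is also a neighbour of [v]. Complementing at [v] turns [z0] and [z'] into false twins, so [z0]
    can be smoothed after [u]. *)
Lemma step_nontwin v z0 z : (forall c, c \in labels w -> exists u, twins w c u) ->
  e v z0 -> z != z0 -> z != v -> e z0 z != e v z -> trefoil_reach w.
Proof.
move=> all_tw vz0 zz0 zv nt; have vw := il_unused wfw vz0.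
have [u tvu] := all_tw v vw; have [vu tu] := tvu.
have z0w : z0 \in labels w by apply: (@il_unused _ _ z0 v); rewrite // il_sym.
have uw : u \in labels w by apply: (@il_unused _ _ u v); rewrite // il_sym.
have [z' [zz' tz]] := all_tw z0 z0w.
have z0v : z0 != v by rewrite eq_sym (il_neq vz0).
have z0u : z0 != u.
  by apply: contraNneq nt => h; rewrite h tu // -?h.
have z'v : z' != v by apply: contraNneq nt => h; rewrite tz // h.
have z'u : z' != u.
  apply: contraNneq nt => h; case: (eqVneq z z') => [->|zz]; first by rewrite zz' h vu.
  by rewrite tz // h tu // -h.
have vz' : e v z'.
  by rewrite il_sym // -tz // il_sym.
have z0z' := il_neq zz'.
have [c [w2 [cw g2 r2 u2 [n2 v2 i2]]]] := twin_swap tvu; have [wf2 _ _ _] := g2.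
have inn p : p \in labels w -> p != c by move=> h; apply: contraNneq cw => <-.
have z'w : z' \in labels w by apply: (@il_unused _ _ z' v); rewrite // il_sym.
have [z0c z'c vc] := And3 (inn _ z0w) (inn _ z'w) (inn _ vw).
(* [z'], the twin of [z0] in [w], now distinguishes [z0] from its neighbours *)
have n0 : il w2 z0 z' = false by rewrite i2 // zz' vz0 vz'.
have [||w3 [g3 r3 u3 _]] := @smooth_move _ w2 z0 g2.
- by rewrite u2 in_setD1 z0u in_setU1 z0w orbT.
- move=> x z0x; exists z'.
  have xz' : x != z' by apply: contraTneq z0x => ->; rewrite n0.
  have xz0 : x != z0 by rewrite eq_sym (il_neq z0x).
  have xu : x != u.
    apply: contraTneq (_ : il w2 x z0); last by rewrite il_sym.
    by move=> ->; apply/negP => /(il_unused wf2); rewrite u2 !inE eqxx.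
  split; [by rewrite eq_sym|by rewrite eq_sym|rewrite n0].
  suff -> : il w2 x z' by [].
  case: (eqVneq x c) => [->|xc]; first by rewrite n2.
  case: (eqVneq x v) => [->|xv]; first by rewrite v2.
  by move: z0x; rewrite !i2 // // vz' vz0 andbT /= (il_sym x) // -tz.
apply/r2/r3/IH => //; rewrite u3 u2; exact: card_swap.
Qed.

(** Complementing at [v] separates [u2] from [u3]. At most [v] and its copy [c] stay adjacent to
    [u2], and both are adjacent to [u3], so [u2] can be smoothed after [u1]. *)
Lemma step_big_clique v u1 u2 u3 : twins w v u1 -> twins w v u2 -> e v u3 ->
  u1 != u2 -> u1 != u3 -> u2 != u3 -> trefoil_reach w.
Proof.
move=> t1 [vu2 t2] vu3 n12 n13 n23.
have [vu1 _] := t1.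
have [c [w2 [cw g2 r2 e2 [q2 v2 i2]]]] := twin_swap t1; have [wf2 _ _ _] := g2.
have inn p : e v p -> [/\ p \in labels w, p != c & p != v].
  move=> h; have pw : p \in labels w by apply: (@il_unused _ _ p v); rewrite // il_sym.
  by split=> //; [apply: contraNneq cw => <-|rewrite eq_sym (il_neq h)].
have [w1' c1 v1'] := inn _ vu1; have [w2' c2 v2'] := inn _ vu2; have [w3' c3 v3'] := inn _ vu3.
have vc : v != c by apply: contraNneq cw => <-; exact: (il_unused wfw vu1).
have z23 : il w2 u2 u3 = false.
  by rewrite i2 // // -t2 // vu2 vu3.
have [||w3 [g3 r3 e3 _]] := @smooth_move _ w2 u2 g2.
- by rewrite e2 in_setD1 eq_sym n12 in_setU1 w2' orbT.
- move=> x ux; exists u3.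
  have xu3 : x != u3 by apply: contraTneq ux => ->; rewrite z23.
  have xu2 : u2 != x by exact: il_neq ux.
  have xu1 : x != u1.
    apply: contraTneq (_ : il w2 x u2); last by rewrite il_sym.
    by move=> ->; apply/negP => /(il_unused wf2); rewrite e2 !inE eqxx.
  split; [by rewrite eq_sym|by rewrite eq_sym|rewrite z23].
  suff -> : il w2 x u3 by [].
  case: (eqVneq x c) => [->|xc]; first by rewrite q2 // eq_sym.
  case: (eqVneq x v) => [->|xv]; first by rewrite v2 // eq_sym.
  by move: ux; rewrite i2 // // -t2 // vu2 addbb.
apply/r2/r3/IH => //; rewrite e3 e2; apply: card_swap => //; by rewrite eq_sym.
Qed.

(** Two consecutive letters lie in different cliques. With opposite signs [opposite_move] applies at
    once. With equal signs a neighbour [u] of [x] is doubled first, which changes the sign of [x]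
    but not that of [y], and [u] is smoothed at the end: two crossings are added and three
    removed. *)
Lemma step_two_cliques l : (forall x u, e x u -> twins w x u) -> l \in w ->
  l.1 != (next w l).1 -> ~~ e l.1 (next w l).1 -> trefoil_reach w.
Proof.
move=> cl lw; set m := next w l => lm nil; have [_ _ _ iw] := gw.
have mw : m \in w by rewrite mem_next.
set x := l.1 in lm nil *; set y := m.1 in lm nil *.
have xw : x \in labels w by rewrite -mem_wf.
have yw : y \in labels w by rewrite -mem_wf.
have yx : e y x = false by rewrite il_sym // (negbTE nil).
have dis z : ~~ (e x z && e y z).
  apply/negP => /andP[xz yz]; have [_ h] := cl _ _ xz.
  have := h y; rewrite eq_sym lm (negbTE nil) (il_sym z) // yz.
  by move=> /(_ isT (il_neq yz)).
case: (eqVneq m.2 l.2) => sg; last first.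
  have [d dw] := fresh_label.
  have [||||||w' [g' r' u' _ _]] := @opposite_move w l m d gw lw mw => //.
  - by left.
  - by case: (m.2) sg; case: (l.2).
  by apply/r'/IH => //; rewrite u'; apply: card_swap.
have [u xu] := iw x xw; have [_ txu] := cl _ _ xu.
have uw : u \in labels w by apply: (@il_unused _ _ u x); rewrite // il_sym.
have [c cw] := fresh_label.
have [d dc dw] := fresh_label2 c.
have ux : e u x by rewrite il_sym.
have nxu := il_neq xu.
have nyu : y != u by apply: contraNneq nil => ->.
have uy : e u y = false by rewrite -txu // // (negbTE nil).
have [w1 [g1 r1 u1 [n1 i1] adj]] := twin_move gw uw cw; have [wf1 _ _ _] := g1.
have [[lw1 mw1] nb1] := adj l m lw erefl nxu nyu.
rewrite -/x -/y ux uy addbT addbF in lw1 mw1 nb1.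
have inn p : p \in labels w -> p != c by move=> h; apply: contraNneq cw => <-.
have ind p : p \in labels w -> p != d by move=> h; apply: contraNneq dw => <-.
have xc := inn _ xw; have yc := inn _ yw; have uc := inn _ uw.
have xd := ind _ xw; have yd := ind _ yw; have ud := ind _ uw.
have x1u : il w1 x u by rewrite i1 // il_irr andbF addbF.
have x1c : il w1 x c by rewrite il_sym // n1.
(* Complementing at [u] cuts [x] off from the rest of its clique; its neighbours [u] and [c] are not
   adjacent to [y]. *)
have x1E p : p != u -> p != c -> il w1 x p = false.
  move=> pu pc; case: (eqVneq x p) => [<-|xp]; first by rewrite il_irr.
  by rewrite i1 // ux txu // addbb.
have y1c : il w1 y c = false by rewrite il_sym // n1.
have y1E p : p != c -> il w1 y p = e y p.
  move=> pc; case: (eqVneq y p) => [<-|yp]; first by rewrite !il_irr.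
  by rewrite i1 // uy addbF.
have [|||||w2 [g2 r2 u2 n2 i2]] := @opposite_move w1 (x, ~~ l.2) (y, m.2) d g1 lw1 mw1 nb1 => //.
- by rewrite /= negbK.
- by rewrite /= x1E // eq_sym.
- move=> z /=; case: (eqVneq z c) => [->|zc]; first by rewrite y1c andbF.
  case: (eqVneq z u) => [->|zu]; last by rewrite x1E.
  by rewrite y1E // (il_sym y) // uy andbF.
- by rewrite u1 in_setU1 negb_or dc.
rewrite /= in n2 i2 u2; have [wf2 _ _ _] := g2.
have uu2 : u \in labels w2.
  by rewrite u2 u1 !in_setD1 !in_setU1 uw !orbT eq_sym nyu eq_sym nxu.
have cy : c != y by rewrite eq_sym.
have cx : c != x by rewrite eq_sym.
have ux' : u != x by rewrite eq_sym.
have uy' : u != y by rewrite eq_sym.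
have uc2 : il w2 u c = false.
  rewrite i2 // // x1u y1c x1c y1E // (il_sym y) // uy (il_sym u) // n1 il_irr //.
(* [c] is still a false twin of [u], hence adjacent to every neighbour of [u]. *)
have [||w3 [g3 r3 u3 _]] := @smooth_move _ w2 u g2 => //.
- move=> z uz; exists c.
  have zc : z != c by apply: contraTneq uz => ->; rewrite uc2.
  have zu : z != u by rewrite eq_sym (il_neq uz).
  have zw2 : z \in labels w2 by apply: (@il_unused _ _ z u); rewrite // il_sym.
  have [zx zy] : z != x /\ z != y.
    by move: zw2; rewrite u2 !in_setD1 => /and3P[? ? _].
  split; [by rewrite eq_sym|by rewrite eq_sym|rewrite uc2].
  suff -> : il w2 z c by [].
  case: (eqVneq z d) => [->|zd]; first by rewrite n2 // // x1c y1c.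
  move: uz; rewrite !i2 // // x1u x1c y1c (x1E z) // !y1E // (il_sym y u) // uy /=.
  rewrite (il_sym z) // n1 i1 // // il_irr /= !addbF.
  by rewrite andbT.
apply/r1/r2/r3/IH => //; rewrite u3 u2 u1.
exact: card_swap2.
Qed.

End Step.
End Reduction.

(** * The small cases *)

Section Base.
Variable T : finType.
Implicit Types (l m : T * bool) (w : seq (T * bool)) (c u v x y z : T).

(** A face runs along both parallel edges and meets [x] at two opposite corners. *)
Lemma no_parallel w x y : wf w -> corners_distinct w -> (x, false) \in w ->
  next w (x, false) = (y, false) -> next w (x, true) = (y, true) -> False.
Proof.
move=> wfw cd xw h1 h2; have uw := wf_uniq wfw.
have p2 : prev w (y, true) = (x, true) by rewrite -h2 prev_next.
have ne : ((x, false), true) != ((x, false), false) by rewrite xpair_eqE andbF.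
have /negP := cd ((x, false), true) ((x, false), false) xw erefl ne; apply.
have s1 : wphi w ((x, false), true) = ((y, true), false).
  by rewrite wphiE // /dphi dalp_out h1.
have s2 : wphi w ((y, true), false) = ((x, false), false).
  by rewrite wphiE // /dphi dalp_in p2.
by rewrite -eq_porbit_mem -s2 -s1 !porbit_step.
Qed.

Definition tword u v z : seq (T * bool) :=
  [:: (u, true); (v, false); (z, true); (u, false); (v, true); (z, false)].

(** The residue modulo 4 is the counterclockwise position used by [tref_sig]. Outgoing darts get 1
    and 2, the positions whose edges lead to the next crossing. *)
Definition tcode (j : nat) (b o : bool) :=
  4 * j + (if b then (if o then 2 else 0) else (if o then 1 else 3)).

Lemma tcode_inj j b o j' b' o' : tcode j b o = tcode j' b' o' -> [/\ j = j', b = b' & o = o'].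
Proof. by rewrite /tcode; case: b; case: o; case: b'; case: o' => h; split=> //; lia. Qed.

Lemma tcode_lt j b o : j < 3 -> tcode j b o < 12.
Proof. by rewrite /tcode; case: b; case: o; lia. Qed.

Lemma tcode_sig j b o : j < 3 ->
  tref_sig (inord (tcode j b o)) = inord (tcode j (~~ b) (b (+) o)).
Proof.
by move=> hj; rewrite /tref_sig inordK ?tcode_lt //; move: j hj => [|[|[|]]] // _;
  case: b; case: o.
Qed.

Lemma tcode_alp j b o : j < 3 ->
  tref_alp (inord (tcode j b o)) = inord (tcode ((if o then j + 1 else j + 2) %% 3) (~~ b) (~~ o)).
Proof.
by move=> hj; rewrite /tref_alp inordK ?tcode_lt //; move: j hj => [|[|[|]]] // _;
  case: b; case: o.
Qed.

Lemma tword_trefoil p u v z : wf (tword u v z) -> #|labels (tword u v z)| = 3 ->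
  models p (tword u v z) -> is_trefoil p.
Proof.
move=> wfw c3 mp; have c12 := models_card wfw mp; case: mp => f [fi fim fs fa].
set w := tword u v z in wfw c3 c12 fim fa; have uw := wf_uniq wfw.
pose lab j := nth u [:: u; v; z] j.
have nextE j b : j < 3 -> next w (lab j, b) = (lab ((j + 1) %% 3), ~~ b).
  move: j => [|[|[|]]] // _; case: b; rewrite /lab /=.
  - by have [] := @adj_cat _ [::] (u, true) (v, false) [:: (z, true); (u, false); (v, true); (z, false)] uw.
  - by have [] := @adj_cat _ [:: (u, true); (v, false); (z, true)] (u, false) (v, true) [:: (z, false)] uw.
  - by have [] := @adj_cat _ [:: (u, true); (v, false); (z, true); (u, false)] (v, true) (z, false) [::] uw.
  - by have [] := @adj_cat _ [:: (u, true)] (v, false) (z, true) [:: (u, false); (v, true); (z, false)] uw.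
  - by have [] := @adj_cat _ [:: (u, true); (v, false)] (z, true) (u, false) [:: (v, true); (z, false)] uw.
  - by have [] := adj_last uw.
have prevE j b : j < 3 -> prev w (lab j, b) = (lab ((j + 2) %% 3), ~~ b).
  move=> hj; have h3 : (j + 2) %% 3 < 3 by rewrite ltn_mod.
  have := nextE _ (~~ b) h3; rewrite negbK modnDml.
  have -> : j + 2 + 1 = j + 3 by rewrite -addnA.
  rewrite modnDr (modn_small hj) => <-.
  by rewrite prev_next.
have repr (x : kd p) : exists j b o, j < 3 /\ f x = ((lab j, b), o).
  have : (f x).1 \in w by apply/fim; exists x.
  case: (f x) => l o /=; rewrite !inE.
  case/orP=> [/eqP->|]; first by exists 0, true, o.
  case/orP=> [/eqP->|]; first by exists 1, false, o.
  case/orP=> [/eqP->|]; first by exists 2, true, o.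
  case/orP=> [/eqP->|]; first by exists 0, false, o.
  case/orP=> [/eqP->|/eqP->]; first by exists 1, true, o.
  by exists 2, false, o.
have lab_inj j j' : j < 3 -> j' < 3 -> lab j = lab j' -> j = j'.
  have : uniq [:: u; v; z].
    have := mask_uniq uw [:: true; false; true; false; true; false].
    rewrite /= !inE !xpair_eqE !andbT !negb_or => /andP[/andP[uz uv] zv].
    by rewrite uv uz eq_sym zv.
  by move=> un h1 h2 /eqP; rewrite /lab nth_uniq // => /eqP.
pose F (x : kd p) : 'I_12 := inord (tcode (index (f x).1.1 [:: u; v; z]) (f x).1.2 (f x).2).
have FE (x : kd p) j b o : j < 3 -> f x = ((lab j, b), o) -> F x = inord (tcode j b o).
  move=> hj e; rewrite /F e /=; congr (inord (tcode _ _ _)).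
  have hm : lab j \in [:: u; v; z] by apply: mem_nth.
  by apply: lab_inj => //; [move: hm; rewrite -index_mem|rewrite {1}/lab nth_index].
exists F; split; last split.
- apply: inj_card_bij; last by rewrite card_ord c12 c3.
  move=> x y e; have [j [b [o [hj ex]]]] := repr x; have [j' [b' [o' [hj' ey]]]] := repr y.
  move: (congr1 val e); rewrite (FE _ _ _ _ hj ex) (FE _ _ _ _ hj' ey) /= !inordK ?tcode_lt //.
  by case/tcode_inj => e1 e2 e3; apply: fi; rewrite ex ey e1 e2 e3.
- move=> x; have [j [b [o [hj ex]]]] := repr x.
  have es : f (ksig p x) = ((lab j, ~~ b), b (+) o) by rewrite fs ex.
  by rewrite (FE _ _ _ _ hj ex) (FE _ _ _ _ hj es) tcode_sig.
- move=> x; have [j [b [o [hj ex]]]] := repr x.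
  have ea : f (kalp p x) = ((lab ((if o then j + 1 else j + 2) %% 3), ~~ b), ~~ o).
    by rewrite fa ex; case: (o); rewrite ?dalp_out ?dalp_in ?nextE ?prevE.
  by rewrite (FE _ _ _ _ hj ex) (FE _ _ _ _ _ ea) ?tcode_alp // ltn_mod.
Qed.

(** Every other label occurs once on each arc between the passages of [u]. For arcs of length one,
    [no_parallel] excludes both signs. For length two, both arcs have the same order of labels, as
    otherwise these would not be interlaced, and [no_parallel] leaves only the alternating signs of
    [tword]. *)
Lemma small_clique w : good w -> #|labels w| <= 3 ->
  (forall p q, p \in labels w -> q \in labels w -> p != q -> il w p q) -> trefoil_reach w.
Proof.
move=> gw le3 cl; have [wfw w0 _ iw] := gw; have cd := good_corners_distinct gw.
have /card_gt0P[u uw] := card_labels_gt0 gw.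
have [|i [X [Y e]]] := @rot_letter _ w (u, true) wfw; first by rewrite mem_wf.
apply: (@trefoil_reach_rot _ i) => //.
have gr : good (rot i w) by apply/good_rot.
have cr : corners_distinct (rot i w) by exact: good_corners_distinct.
have ir p q : il (rot i w) p q = il w p q by exact: il_rot.
have ur : labels (rot i w) = labels w by exact: labels_rot.
move: (rot i w) e gr cr ir ur => r e gr cr ir ur; have [wfr _ _ _] := gr.
have un := wf_uniq wfr; have wfc := wfr; rewrite e in wfc.
have uX : uniq X by move: un; rewrite e cons_uniq cat_uniq => /and4P[].
have uY : uniq Y by move: un; rewrite e cons_uniq cat_uniq /= => /andP[_ /and3P[_ _ /andP[]]].
have cX p : count_mem p (map fst X) = (p \in labels w :\ u).
  have oX : il w u p = odd (count_mem p (map fst X)).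
    by rewrite -oddX_count // -(il_center wfc) -e ir.
  rewrite in_setD1; case: (eqVneq p u) => [->|pu] /=.
    by have [] := oddX_centerY wfc.
  case: (boolP (p \in labels w)) => pw.
    move: oX; rewrite cl // 1?eq_sym // count_label //.
    by case: (_ \in X); case: (_ \in X).
  have nX b : (p, b) \in X = false.
    apply/negP => h; have : (p, b) \in r by rewrite e inE mem_cat h orbT.
    by rewrite mem_wf // ur (negbTE pw).
  by rewrite count_label // !nX.
have cY p : count_mem p (map fst Y) = (p \in labels w :\ u).
  have := wf_count p wfr; rewrite e /= map_cat count_cat /= cX -e ur in_setD1.
  case: (eqVneq p u) => [->|pu] /=; last by case: (p \in labels w) => /=; clear; lia.
  by have [_ ->] := oddX_centerY wfc.
have mX p : (p \in map fst X) = (p \in labels w :\ u) by rewrite -has_pred1 has_count cX lt0b.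
have mY p : (p \in map fst Y) = (p \in labels w :\ u) by rewrite -has_pred1 has_count cY lt0b.
have uLX : uniq (map fst X) by apply/count_mem_uniq => p; rewrite cX mX.
have uLY : uniq (map fst Y) by apply/count_mem_uniq => p; rewrite cY mY.
have sX : size X = #|labels w :\ u|.
  by rewrite -(size_map fst X) -(card_uniqP uLX); apply: eq_card => p; exact: mX.
have sY : size Y = #|labels w :\ u|.
  by rewrite -(size_map fst Y) -(card_uniqP uLY); apply: eq_card => p; exact: mY.
have cu := cardsD1 u (labels w); rewrite uw /= in cu.
have nextE A l m B : r = A ++ l :: m :: B -> next r l = m.
  by move=> h; have [] := @adj_cat _ A l m B; rewrite -?h.
have nextL m A : r = m :: A -> next r (last m A) = m.
  by move=> h; have [] := @adj_last _ m A; rewrite -?h.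
have same l m A B C : r = A ++ l :: B ++ m :: C -> l.1 = m.1 -> m = bar l.
  move=> h hl; have [hm|//] := same_label hl; exfalso.
  by move: un; rewrite h hm cat_uniq cons_uniq mem_cat mem_head orbT /= !andbF.
have : 0 < #|labels w :\ u|.
  have [v hv] := iw u uw; apply/card_gt0P; exists v; rewrite in_setD1 eq_sym (il_neq hv).
  by apply: (@il_unused _ _ v u); rewrite // il_sym.
case n: #|labels w :\ u| => [|[|[|k]]] // _; last by move: le3; rewrite cu n.
  rewrite n in sX sY; case: X sX e wfc uX cX mX uLX => [|l [|]] // _ e wfc uX cX mX uLX.
  case: Y sY e wfc uY cY mY uLY => [|m [|]] // _ e wfc uY cY mY uLY; exfalso.
  have lm : l.1 = m.1.
    by apply/eqP; have := mY l.1; rewrite -mX /= !inE eqxx.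
  have em : m = bar l by apply: (same l m [:: (u, true)] [:: (u, false)] [::]).
  case: l em e {lm uX cX mX uLX wfc} => v [] /= em e.
    have uf : (u, false) \in r by rewrite mem_wf // ur.
    apply: (@no_parallel r u v) => //; rewrite em /bar /= in e.
      exact: (nextE [:: (u, true); (v, true)] _ _ [::]).
    exact: (nextE [::] _ _ [:: (u, false); (v, false)]).
  rewrite em /bar /= in e.
  apply: (@no_parallel r v u) => //; first by rewrite e !inE eqxx orbT.
    exact: (nextE [:: (u, true)] _ _ [:: (v, true)]).
  exact: (nextL _ [:: (v, false); (u, false); (v, true)]).
rewrite n in sX sY cu.
case: X sX e wfc uX cX mX uLX => [|l1 [|l2 [|]]] // _ e wfc uX cX mX uLX.
case: Y sY e wfc uY cY mY uLY => [|m1 [|m2 [|]]] // _ e wfc uY cY mY uLY.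
have l12 : l1.1 != l2.1 by move: uLX; rewrite /= inE andbT.
have m12 : m1.1 != m2.1 by move: uLY; rewrite /= inE andbT.
have i1 : l1.1 \in labels w :\ u by rewrite -mX mem_head.
have i2 : l2.1 \in labels w :\ u by rewrite -mX !inE eqxx orbT.
have m1E : (m1.1 == l1.1) || (m1.1 == l2.1).
  by have := mX m1.1; rewrite -mY /= !inE eqxx.
have m2E : (m2.1 == l1.1) || (m2.1 == l2.1).
  by have := mX m2.1; rewrite -mY /= !inE eqxx orbT.
case/orP: m1E => /eqP m1E; last first.
  case/orP: m2E => /eqP m2E; last by rewrite m1E m2E eqxx in m12.
  move: i1 i2; rewrite !in_setD1 => /andP[n1 w1] /andP[n2 w2]; exfalso.
  have := cl _ _ w1 w2 l12; rewrite -ir e /il l12 /= m1E m2E !eqxx.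
  by rewrite (eq_sym l2.1 l1.1) (negbTE l12) !(eq_sym u) (negbTE n1) (negbTE n2).
case/orP: m2E => /eqP m2E; first by rewrite m1E m2E eqxx in m12.
have e1 : m1 = bar l1.
  by apply: (same l1 m1 [:: (u, true)] [:: l2; (u, false)] [:: m2]); rewrite // m1E.
have e2 : m2 = bar l2.
  by apply: (same l2 m2 [:: (u, true); l1] [:: (u, false); m1] [::]); rewrite // m2E.
have uf : (u, false) \in r by rewrite mem_wf // ur.
move: e; rewrite e1 e2 => e.
case: l1 l2 e e1 e2 {m1E m2E i1 i2 l12 uX cX mX uLX wfc} => v b1 [z b2] e _ _.
rewrite /bar /= in e.
case: b1 e => /= e.
  exfalso; apply: (@no_parallel r u v) => //.
    exact: (nextE [:: (u, true); (v, true); (z, b2)] _ _ [:: (z, ~~ b2)]).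
  exact: (nextE [::] _ _ [:: (z, b2); (u, false); (v, false); (z, ~~ b2)]).
case: b2 e => /= e; last first.
  exfalso; apply: (@no_parallel r v z) => //; first by rewrite e !inE eqxx orbT.
    exact: (nextE [:: (u, true)] _ _ [:: (u, false); (v, true); (z, true)]).
  exact: (nextE [:: (u, true); (v, false); (z, false); (u, false)] _ _ [::]).
move=> p mp; exists p; split; last exact: reach0.
by rewrite e in mp ur wfr; apply: tword_trefoil mp => //; rewrite /tword ur cu.
Qed.

Lemma good_reach w : good w -> #|labels w| + 2 <= #|T| -> trefoil_reach w.
Proof.
have [n] := ubnP #|labels w|; elim: n w => // n IHn w lt gw fr.
have IH w' : good w' -> #|labels w'| < #|labels w| -> trefoil_reach w'.
  by move=> g' l'; apply: IHn => //; lia.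
have [wfw w0 _ _] := gw.
case: (boolP [exists c in labels w, ~~ twinb w c]) => [/existsP[c /andP[cw h]]|/existsPn h1].
  exact: (step_twinless gw IH cw (twinbPn h)).
have all_tw c : c \in labels w -> exists u, twins w c u.
  by move=> cw; have := h1 c; rewrite cw negbK => /twinbP.
case: (boolP [exists x, exists u, exists z, [&& il w x u, z != u, z != x & il w u z != il w x z]]).
  move=> /existsP[x /existsP[u /existsP[z /and4P[xu zu zx hz]]]].
  exact: (step_nontwin gw fr IH all_tw xu zu zx hz).
move=> h2; have cl x u : il w x u -> twins w x u.
  move=> xu; split=> // z zx zu; apply/eqP; rewrite eq_sym; apply: contraR h2 => hz.
  by apply/existsP; exists x; apply/existsP; exists u; apply/existsP; exists z; rewrite xu zu zx.
case: (boolP [exists l, [&& l \in w, l.1 != (next w l).1 & ~~ il w l.1 (next w l).1]]).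
  by move=> /existsP[l /and3P[lw h3 h4]]; exact: (step_two_cliques gw fr IH cl lw h3 h4).
move=> /existsPn h3.
have /card_gt0P[u0 uw] := card_labels_gt0 gw.
(* Consecutive labels are now equal or adjacent, so a walk along the curve from [u0] never leaves
   the clique of [u0]. *)
have near p : p \in labels w -> p = u0 \/ il w u0 p.
  rewrite -[p \in _](mem_wf (p, true)) // => pw.
  have lw : (u0, true) \in w by rewrite mem_wf.
  have [k hk] := fconnect_next (wf_uniq wfw) lw pw; rewrite -[p]/((p, true).1) -hk.
  elim: k {hk} => [|k IHk]; first by left.
  have kw : iter k (next w) (u0, true) \in w by elim: (k) => //= j; rewrite mem_next.
  rewrite iterS; move: (iter k _ _) kw IHk => l kw IHk.
  have := h3 l; rewrite kw /= negb_and !negbK => /orP[/eqP <- //|hl].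
  case: IHk => [<-|h]; first by right.
  case: (eqVneq (next w l).1 u0) => [->|ne]; [by left|right].
  by have [_ ->] := cl _ _ h; rewrite // eq_sym (il_neq hl).
have clq p q : p \in labels w -> q \in labels w -> p != q -> il w p q.
  move=> pw qw pq; case: (near p pw) => [ep|hp]; case: (near q qw) => [eq|hq].
  - by rewrite ep eq eqxx in pq.
  - by rewrite ep.
  - by rewrite eq il_sym.
  - have [_ h] := cl _ _ hp; rewrite -h // 1?eq_sym //; exact: il_neq hq.
case: (leqP #|labels w| 3) => [le3|gt3]; first exact: small_clique.
have : 2 < #|labels w :\ u0| by have := cardsD1 u0 (labels w); rewrite uw; lia.
case/card_gt2P => u1 [u2 [u3 [[]]]]; rewrite !in_setD1.
move=> /andP[n1 w1] /andP[n2 w2] /andP[n3 w3] [n12 n23 n31].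
have a1 : il w u0 u1 by apply: clq; rewrite // eq_sym.
have a2 : il w u0 u2 by apply: clq; rewrite // eq_sym.
have a3 : il w u0 u3 by apply: clq; rewrite // eq_sym.
by apply: (step_big_clique gw fr IH (cl _ _ a1) (cl _ _ a2) a3); rewrite // eq_sym.
Qed.

End Base.

Theorem theorem1 (p : kproj) :
  kreduced p ->
  exists t : kproj, is_trefoil t /\ reach kstep preduced (NT t) (NT p).
Proof.
move=> red; have /card_gt0P[x0 _] := kproj_nonempty p.
have wfw := gword_wf x0; have mp := gword_models x0.
have cd := proj1 (models_reduced wfw mp) red.
have gw : good (gword x0).
  split=> //; [|exact: models_planar mp|exact: corners_distinct_no_isolated].
  have /(gdart_im x0) : exists x, gdart x0 x = gdart x0 x0 by exists x0.
  by case: (gword x0).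
have c4 := models_card wfw mp; have c0 := card_labels_gt0 gw.
(* Labels are darts of [p], four for each of at least one crossing, so two are spare. *)
by apply: (good_reach gw) mp; rewrite c4; lia.
Qed.
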